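(* Let $(R,F)$ be a rooted graph with $e_{F_-}>1$. For every $\beta>0$ there exists $\mu=\mu(\beta)>0$ such that for every $A\ge 1$ there exists $\alpha=\alpha(A,\beta)>0$ such that for every function $q=q(n)>0$ with $q(n)=o(1)$ the following holds for all sufficiently large $n$. Suppose that $$m\ge \alpha^{-1}n^{2-1/m_2(R,F,-\log_n q)}$$ and that $G_R\in\mathcal R(R,n)$ is $(F,Aq)$-upper-extensible as well as $(F,q,\mu)$-lower-regular. Then the number of graphs $G$ in $\mathcal G(F_-,n,m,\mu)$ for which $T(G,G_R)$ contains fewer than $$\alpha\left(\frac{m}{n^2}\right)^{e_{F_-}}q^{e_{F[R]}}n^{v_F}$$ edges (counted with multiplicity) is at most $$\beta^m\binom{n^2}{m}^{e_F-e_{F[R]}}.$$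
   Context: Graphs are finite and simple; $v_G,e_G$ are the numbers of vertices and edges. A rooted graph $(R,F)$ is a graph $F$ with an ordered subset $R\subseteq V(F)$ of roots. $F[R]$ is the induced subgraph on $R$, and $F_-$ is the graph on $V(F)$ obtained from $F$ by removing all edges of $F[R]$ (so $e_{F_-}=e_F-e_{F[R]}$). For a set $V$, $V'\subseteq_\varepsilon V$ means $V'\subseteq V$ and $|V'|\ge\varepsilon|V|$. Rooted $2$-density. For a rooted graph $(R,H)$ write $\overline e_H=e_H-e_{H[R]}$. For $t\ge0$ let $d_2(R,H,t)=\frac{\overline e_H-1}{v_H-2-t\,e_{H[R]}}$ if $v_H-2-t\,e_{H[R]}>0$ and $d_2(R,H,t)=\infty$ otherwise. Let $m_2(R,F,t)=\max d_2(R\cap V(H),H,t)$, the maximum over all subgraphs $H\subseteq F$ with $e_H-e_{H[R\cap V(H)]}>1$. ($1/\infty=0$.) Regular graphs. A bipartite graph $(U\cup W,E)$ is $(\varepsilon)$-regular if, with $d=|E|/(|U||W|)$, for all $U'\subseteq_\varepsilon U$, $W'\subseteq_\varepsilon W$ we have $\left|\frac{|E(U',W')|}{|U'||W'|}-d\right|\le\varepsilon d$. Let $(V_i)_{i\in V(F)}$ be pairwise disjoint sets of size $n$. For a graph $F'$ on $V(F)$, $\mathcal G(F',n,m,\varepsilon)$ is the class of graphs $G$ on $\bigcup_i V_i$ such that for every $\{i,j\}\in E(F')$ the pair $(V_i,V_j)$ is $(\varepsilon)$-regular with exactly $m$ edges, and there are no other edges. A partite copy of $F'$ in $G$ is a choice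 of vertices $v_i\in V_i$, $i\in V(F')$, with $\{v_i,v_j\}\in E(G)$ whenever $\{i,j\}\in E(F')$. Hypergraphs on the roots. $\mathcal R(R,n)$ is the class of partite $|R|$-uniform hypergraphs with parts $V_i$, $i\in R$ (each edge contains one vertex from each part). $G_R\in\mathcal R(R,n)$ is $(F,q,\varepsilon)$-lower-regular if all tuples of subsets $V_i'\subseteq_\varepsilon V_i$ ($i\in R$) induce at least $q^{e_{F[R]}}\prod_{i\in R}|V_i'|$ edges. $G_R$ is $(F,q)$-upper-extensible if for every induced subgraph $F'\subseteq F[R]$ every tuple in $\prod_{i\in V(F')}V_i$ has degree in $G_R$ (number of edges containing it) at most $q^{e_{F[R]}-e_{F'}}n^{|R|-v_{F'}}$. $T(G,G_R)$ is the multi-hypergraph on the sets $V_i$ ($i\in R$) containing each edge $e\in E(G_R)$ with multiplicity equal to the number of partite copies of $F_-$ in $G$ which contain all vertices of $e$. *)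

(* Defs.v *)
From mathcomp Require Import all_boot all_order all_algebra.
From mathcomp Require Import boolp classical_sets reals constructive_ereal exp.
From mathcomp Require Import filter topology normedtype sequences.
Set Implicit Arguments.
Unset Strict Implicit.
Unset Printing Implicit Defensive.

Import Order.TTheory GRing.Theory Num.Theory.
Import numFieldNormedType.Exports.
Local Open Scope ring_scope.

(* A finite simple graph is given by its set of edges, an edge being a
   two-element set of vertices; its vertex set is fixed by the context. *)
Section Graphs.
Variable V : finType.
Implicit Types (E : {set {set V}}) (S A B : {set V}).

Definition simple_graph E := forall e, e \in E -> #|e| = 2%N.

Definition induced_edges E S : {set {set V}} := [set e in E | e \subset S].

(* The edges of F_- : those of F that do not lie inside the root set S. *)
Definition nonroot_edges E S : {set {set V}} := E :\: induced_edges E S.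

(* A subgraph is a pair (vertex set, edge set). *)
Definition is_subgraph E (H : {set V} * {set {set V}}) : bool :=
  (H.2 \subset E) && [forall e in H.2, e \subset H.1].

Definition edges_between E A B : {set {set V}} :=
  [set e in E | [exists u in A, exists w in B, e == [set u; w]]].

End Graphs.

Section RootedDensity.
Variables (R : realType) (V : finType).
Implicit Types (S : {set V}) (H : {set V} * {set {set V}}) (t : R).

Definition root_edges S H : {set {set V}} := induced_edges H.2 (S :&: H.1).

Definition d2 S H t : \bar R :=
  let den := #|H.1|%:R - 2 - t * #|root_edges S H|%:R in
  if 0 < den then ((#|H.2|%:R - #|root_edges S H|%:R - 1) / den)%:E
  else +oo%E.

Definition m2 S (E : {set {set V}}) t : \bar R :=
  \big[maxe/-oo%E]_(H : {set V} * {set {set V}} |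
      is_subgraph E H && (1 < #|H.2| - #|root_edges S H|)%N) d2 S H t.

End RootedDensity.

Section Regularity.
Variables (R : realType) (T : finType).
Implicit Types (U W : {set T}) (eps : R) (G : {set {set T}}).

Definition eps_subset eps (U' U : {set T}) : Prop :=
  U' \subset U /\ eps * #|U|%:R <= #|U'|%:R.

Definition density G U W : R :=
  #|edges_between G U W|%:R / (#|U|%:R * #|W|%:R).

Definition eps_regular eps G U W : Prop :=
  forall U' W', eps_subset eps U' U -> eps_subset eps W' W ->
    `|density G U' W' - density G U W| <= eps * density G U W.

End Regularity.

(* P i is the part V_i belonging to the vertex i of F. *)
Section Blowups.
Variables (R : realType) (V T : finType) (P : V -> {set T}).
Implicit Types (E : {set {set V}}) (S : {set V}) (q eps : R).
Implicit Types (G GR : {set {set T}}).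

Definition disjoint_parts (n : nat) : Prop :=
  (forall i, #|P i| = n) /\ (forall i j, i != j -> [disjoint P i & P j]).

Definition regular_class E (m : nat) eps G : Prop :=
  (forall i j, [set i; j] \in E ->
     eps_regular eps G (P i) (P j) /\ #|edges_between G (P i) (P j)| = m) /\
  (forall e, e \in G -> exists i j,
     [set i; j] \in E /\ e \in edges_between G (P i) (P j)).

Definition partite_copy E G (v : {ffun V -> T}) : bool :=
  [forall i, v i \in P i] &&
  [forall i, forall j, ([set i; j] \in E) ==> ([set v i; v j] \in G)].

Definition partite_hypergraph S GR : Prop :=
  forall e, e \in GR ->
    #|e| = #|S| /\ (forall i, i \in S -> #|e :&: P i| = 1%N).

Definition lower_regular E S q eps GR : Prop :=
  forall W : V -> {set T},
    (forall i, i \in S -> eps_subset eps (W i) (P i)) ->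
    q ^+ #|induced_edges E S| * \prod_(i in S) #|W i|%:R
      <= #|[set e in GR | e \subset \bigcup_(i in S) W i]|%:R.

Definition hyperdegree GR (X : {set T}) : nat := #|[set e in GR | X \subset e]|.

(* Here S' is the vertex set of the induced subgraph F'; only the values of
   x on S' matter. *)
Definition upper_extensible E S (n : nat) q GR : Prop :=
  forall (S' : {set V}) (x : V -> T),
    S' \subset S -> (forall i, i \in S' -> x i \in P i) ->
    (hyperdegree GR [set x i | i in S'])%:R
      <= q ^+ (#|induced_edges E S| - #|induced_edges E S'|)
         * n%:R ^+ (#|S| - #|S'|).

(* The multi-hypergraph T(G, G_R), as a multiplicity function. *)
Definition copy_multiplicity E S G GR (e : {set T}) : nat :=
  if e \in GR then
    #|[set v | partite_copy (nonroot_edges E S) G v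
               & e \subset [set v i | i : V]]|
  else 0%N.

Definition copy_edge_count E S G GR : nat :=
  (\sum_(e : {set T}) copy_multiplicity E S G GR e)%N.

End Blowups.

(* Main.v *)
(* Consider the multi-hypergraph whose vertices are the pairs of vertices in
   distinct parts and whose edges are the edge sets of the copies of F_- resting on
   an edge of G_R.  Upper extensibility bounds its codegrees by its expected size
   times n^(2 - v_H) q^(-e_H[R]), and m >= n^(2 - 1/m_2) / alpha is precisely what
   makes the hypergraph container method applicable at scale m / n^2.  So each G
   with few copies is, up to a tiny part, contained in a container that spans few
   copies and is determined by boundedly many tiny subsets of G.

   A container with few copies is sparse somewhere: if in some tuple of large
   subsets of the parts every pair of large subsets had density above delta, one
   could choose the non-root vertices one by one while keeping linear-size candidate
   sets for the roots, and lower regularity of G_R would then give many copies.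
   Applied repeatedly, this partitions most of the product of the parts into boxes
   with a sparse pair each, and a slice of this partition is a set of pairs of
   proportion at least 1 / (4 v_F^2) in which the container has density at most
   delta.  A regular G has a proportional share of its m edges there, and a
   union bound over the fingerprints shows that only a fraction
   delta^(c m) 2^O(m) of the graphs qualifies. *)

Require Import Defs.
From mathcomp Require Import all_boot all_order all_algebra.
From mathcomp Require Import boolp classical_sets reals constructive_ereal exp.
From mathcomp Require Import filter topology normedtype sequences.
(* fintype and finset come last because classical_sets reuses their lemma names. *)
From mathcomp Require Import lra ring zify fintype finset.
Set Implicit Arguments.
Unset Strict Implicit.
Unset Printing Implicit Defensive.

Import Order.TTheory GRing.Theory Num.Theory.
Import numFieldNormedType.Exports.
Local Open Scope ring_scope.

(** The order of the quantifiers dictates the constants. Since [mu] precedes [A], the density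
    [delta] of a sparse pair and the share [g0] of copies that a container may span must come from
    [beta] and F alone. [A] enters through the codegree constant [K], hence through the number [k]
    of fingerprint sets, their size of order [gam * m], and [alpha]. So sparse pairs are extracted
    with lower regularity, which does not involve [A]. Parallel edges arise because a copy of F_-
    also fixes vertices that no edge of F_- meets, and codegrees must count these choices; edges are
    therefore indexed by copies. A fingerprint is charged the probability that a random G contains
    it, not its number of choices among all pairs. This keeps the union bound exponential in m even
    if m is far below n^2. *)

Ltac pos := solve [repeat first
  [ assumption | done | apply: ltW; assumption
  | apply: divr_gt0 | apply: mulr_gt0 | apply: exprn_gt0 | apply: addr_gt0
  | rewrite invr_gt0 | rewrite ltr0n
  | apply: divr_ge0 | apply: mulr_ge0 | apply: exprn_ge0 | apply: addr_ge0
  | rewrite invr_ge0 | rewrite ler0n ]].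

(** * Containers *)

Section Multihypergraphs.
Variables (X Om : finType).
Implicit Types (A B : {set Om}) (phi : Om -> {set X}) (I S T Y Z : {set X}).

(* A multi-hypergraph on X is a set A of indices with an edge phi w for each
   w in A, so that parallel edges are distinct indices. *)
Definition above A phi T : {set Om} := [set w in A | T \subset phi w].
Definition within A phi I : {set Om} := [set w in A | phi w \subset I].

Lemma in_above A phi T w :
  (w \in above A phi T) = (w \in A) && (T \subset phi w).
Proof. by rewrite inE. Qed.

Lemma in_within A phi I w :
  (w \in within A phi I) = (w \in A) && (phi w \subset I).
Proof. by rewrite inE. Qed.

Lemma sum_card_above A phi I :
  (\sum_(u in I) #|above A phi [set u]| = \sum_(w in A) #|phi w :&: I|)%N.
Proof.
under eq_bigr => u uI do rewrite -sum1_card big_mkcond /=.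
rewrite exchange_big /= [RHS]big_mkcond; apply: eq_bigr => w _.
case: (boolP (w \in A)) => wA; last first.
  by rewrite big1 // => u _; rewrite inE (negPf wA).
rewrite -sum1_card [RHS]big_mkcond [LHS]big_mkcond; apply: eq_bigr => u _.
by rewrite !inE wA sub1set /=; case: (u \in I); case: (u \in phi w).
Qed.

Lemma sum_card_above_all A phi :
  (\sum_T #|above A phi T| = \sum_(w in A) 2 ^ #|phi w|)%N.
Proof.
under eq_bigr => T _ do rewrite -sum1_card big_mkcond /=.
rewrite exchange_big /= [RHS]big_mkcond; apply: eq_bigr => w _.
case: (boolP (w \in A)) => wA; last first.
  by rewrite big1 // => u _; rewrite inE (negPf wA).
rewrite -card_powerset -sum1_card [RHS]big_mkcond; apply: eq_bigr => T _.
by rewrite !inE wA.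
Qed.

Lemma leq_card_cover (I : finType) (P : pred I) (F : I -> {set Om}) A :
  (forall w, w \in A -> exists2 i, P i & w \in F i) ->
  (#|A| <= \sum_(i | P i) #|F i|)%N.
Proof.
move=> cov; under eq_bigr => i _ do rewrite -sum1_card big_mkcond /=.
rewrite exchange_big -sum1_card /= [leqLHS]big_mkcond; apply: leq_sum => w _.
case: ifP => // /cov[i Pi wi].
by rewrite (bigD1 i) //= wi.
Qed.

Lemma disjointsU1r (x : X) S T :
  [disjoint S & x |: T] = (x \notin S) && [disjoint S & T].
Proof.
by rewrite !disjoints_subset setCU subsetI -disjoints_subset disjoint_sym
  disjoints1.
Qed.

End Multihypergraphs.

Section ContainerStep.
Variables (R : realType) (X Om : finType) (r b : nat) (K N : R).
Variables (A : {set Om}) (phi : Om -> {set X}) (Y : {set X}).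
Implicit Types (A : {set Om}) (phi : Om -> {set X}).
Implicit Types (B : {set Om}) (I S T Z : {set X}).
Hypotheses (K1 : 1 <= K) (N0 : 0 < N) (b0 : (0 < b)%N).
Hypotheses (bN : b%:R <= N / (4 * K)) (YN : #|Y|%:R <= N) (A0 : (0 < #|A|)%N).
Hypothesis phi_unif : forall w, w \in A -> #|phi w| = r.+1 /\ phi w \subset Y.
Let E : R := #|A|%:R.
Let t : R := b%:R / N.
Hypothesis codeg : forall T, T != set0 ->
  #|above A phi T|%:R <= K * t ^+ #|T|.-1 * E / N.

(* With the bound [D] on the codegrees of the link hypergraph, the ratio between
   the codegree bounds for A and [D] is 8KN / (b link_const) for every set size.
   Hence all edges through saturated sets number at most |A| / 4. *)
Definition link_const : R := 64 * 2 ^+ r * K ^+ 2.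
Let D l : R := link_const * t ^+ l.-1 * (b%:R * E / (8 * N)) / N.

Definition saturated A1 phi1 T :=
  (T != set0) && (D #|T| < 2 * #|above A1 phi1 T|%:R).

Definition link_of A1 phi1 S :=
  (A1 \subset A) /\
  (forall w, w \in A1 -> exists2 u, u \in S & u \in phi w /\ phi1 w = phi w :\ u).

(* State of the scan: S and Z are the vertices found inside and outside of I, A1
   (with edges phi1) collects the links of S, and B is what remains of A after
   deleting the edges meeting S or Z and those containing a saturated set. *)
Record step_inv B A1 phi1 S Z : Prop := StepInv {
  si_link : link_of A1 phi1 S;
  si_sub : B \subset A;
  si_disj : [disjoint B & A1];
  si_avoid : forall w, w \in B -> [disjoint phi w & S :|: Z];
  si_unsat : forall w T, w \in B -> T \subset phi w -> ~~ saturated A1 phi1 T;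
  si_cover : forall w, w \in A -> w \notin B ->
    ~~ [disjoint phi w & S :|: Z] \/
    exists2 T, saturated A1 phi1 T & T \subset phi w;
  si_deg : forall T, T != set0 -> #|above A1 phi1 T|%:R <= D #|T|;
  si_ge : #|S|%:R * E / (8 * N) <= #|A1|%:R;
  si_le : #|A1|%:R <= #|S|%:R * K * E / N;
  si_Z : Z \subset Y }.

Let E0 : 0 < E. Proof. by rewrite ltr0n. Qed.
Let K0 : 0 < K. Proof. exact: lt_le_trans K1. Qed.
Let bR0 : 0 < b%:R :> R. Proof. by rewrite ltr0n. Qed.
Let t0 : 0 < t. Proof. exact: divr_gt0. Qed.
Let LC0 : 0 < link_const.
Proof. rewrite /link_const; pos. Qed.
Let D0 l : 0 < D l.
Proof. rewrite /D; pos. Qed.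

Let deg1 u : #|above A phi [set u]|%:R <= K * E / N.
Proof.
have := codeg (T := [set u]); rewrite cards1 expr0 mulr1; apply.
by rewrite -card_gt0 cards1.
Qed.

Let card_link A1 phi1 S w : link_of A1 phi1 S -> w \in A1 -> #|phi1 w| = r.
Proof.
case=> /subsetP sub lk wA; have [u uS [uw ->]] := lk w wA.
have [+ _] := phi_unif (sub w wA).
by rewrite (cardsD1 u) uw add1n => -[].
Qed.

(** A saturated T has codegree of order [D #|T|] in A1, so its codegree in A is at most a constant
    multiple of that in A1. Summing over T counts each edge of A1 once per subset, that is 2^r
    times. *)
Lemma saturated_weight A1 phi1 S : link_of A1 phi1 S ->
  \sum_(T | saturated A1 phi1 T) #|above A phi T|%:R <=
    16 * K * N / (b%:R * link_const) * 2 ^+ r * #|A1|%:R :> R.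
Proof.
move=> lk.
have key T : saturated A1 phi1 T -> #|above A phi T|%:R <=
    16 * K * N / (b%:R * link_const) * #|above A1 phi1 T|%:R :> R.
  case/andP=> Tn0 satT; apply: (le_trans (codeg Tn0)).
  have -> : K * t ^+ #|T|.-1 * E / N =
      8 * K * N / (b%:R * link_const) * D #|T|.
    by rewrite /D; field; rewrite ?gt_eqF //.
  have -> : 16 * K * N / (b%:R * link_const) * #|above A1 phi1 T|%:R =
      8 * K * N / (b%:R * link_const) * (2 * #|above A1 phi1 T|%:R) :> R.
    by field; rewrite ?gt_eqF //.
  rewrite ler_pM2l; first exact: ltW.
  pos.
apply: (le_trans (ler_sum _ key)); rewrite -mulr_sumr -[leRHS]mulrA.
rewrite ler_pM2l; last pos.
rewrite -natr_sum -natrX -natrM ler_nat.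
apply: (@leq_trans (\sum_T #|above A1 phi1 T|)%N).
  by rewrite big_mkcond; apply: leq_sum => T _; case: ifP.
rewrite sum_card_above_all (eq_bigr (fun _ => 2 ^ r)%N); last first.
  by move=> w wA1; rewrite (card_link lk wA1).
by rewrite sum_nat_const mulnC.
Qed.

(** S and Z have at most N / (4K) vertices each, of degree at most KE / N, so together they cost E /
    2; the saturated sets cost E / 4. *)
Lemma remaining_large B A1 phi1 S Z : step_inv B A1 phi1 S Z ->
  (#|S| <= b)%N -> #|Z|%:R <= N / (4 * K) -> E / 4 <= #|B|%:R.
Proof.
move=> inv Sb Zs.
have cov : (#|A| <= #|B| + (\sum_(u in S :|: Z) #|above A phi [set u]| +
    \sum_(T | saturated A1 phi1 T) #|above A phi T|))%N.
  have subB : (#|A :\: B| <= \sum_(u in S :|: Z) #|above A phi [set u]| +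
      \sum_(T | saturated A1 phi1 T) #|above A phi T|)%N.
    pose F (i : X + {set X}) := match i with inl u => above A phi [set u]
      | inr T => above A phi T end.
    pose P (i : X + {set X}) := match i with inl u => u \in S :|: Z
      | inr T => saturated A1 phi1 T end.
    apply: leq_trans (@leq_card_cover Om _ P F _ _) _.
      move=> w; rewrite inE => /andP[wB wA].
      have [/pred0Pn[u /= /andP[uw uQ]]|[T sT Tw]] := si_cover inv wA wB.
        by exists (inl u) => //=; rewrite inE wA sub1set.
      by exists (inr T) => //=; rewrite inE wA.
    by rewrite big_sumType.
  by rewrite -(cardsID B A) leq_add // subset_leq_card // subsetIr.
have {cov} : E <= #|B|%:R + (\sum_(u in S :|: Z) #|above A phi [set u]|%:R +
    \sum_(T | saturated A1 phi1 T) #|above A phi T|%:R).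
  by rewrite -!natr_sum -!natrD ler_nat.
have h1 : \sum_(u in S :|: Z) #|above A phi [set u]|%:R <= E / 2 :> R.
  apply: le_trans (ler_sum _ (fun u _ => deg1 u)) _.
  rewrite sumr_const -[leLHS]mulr_natl.
  apply: (@le_trans _ _ ((N / (4 * K) + N / (4 * K)) * (K * E / N))).
    apply: ler_wpM2r; first pos.
    apply: (@le_trans _ _ (#|S| + #|Z|)%:R); first by rewrite ler_nat leq_card_setU.
    rewrite natrD lerD //; apply: le_trans bN; by rewrite ler_nat.
  by rewrite le_eqVlt; apply/orP; left; apply/eqP; field; rewrite ?gt_eqF.
have h2 : \sum_(T | saturated A1 phi1 T) #|above A phi T|%:R <= E / 4 :> R.
  apply: (le_trans (saturated_weight (si_link inv))).
  apply: (@le_trans _ _ (16 * K * N / (b%:R * link_const) * 2 ^+ r *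
            (b%:R * K * E / N))).
    apply: ler_wpM2l.
      pos.
    apply: (le_trans (si_le inv)); apply: ler_wpM2r; first by rewrite invr_ge0 ltW.
    apply: ler_wpM2r; first by rewrite ltW.
    by apply: ler_wpM2r; rewrite ?ler_nat // ltW.
  rewrite le_eqVlt; apply/orP; left; apply/eqP.
  rewrite /link_const; field.
  by rewrite !gt_eqF // exprn_gt0.
by move: h1 h2; lra.
Qed.


(** The degrees sum to at least |B| >= E / 4, whereas poor vertices throughout would give at most N
    * E / (8N) = E / 8. *)
Lemma rich_vertex B : B \subset A -> E / 4 <= #|B|%:R ->
  exists2 u, u \in Y & E / (8 * N) <= #|above B phi [set u]|%:R.
Proof.
move=> BA Bs; apply/exists_inP; apply: contraLR Bs.
rewrite negb_exists -ltNge => /forallP poor.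
have : #|B|%:R <= \sum_(u in Y) #|above B phi [set u]|%:R :> R.
  rewrite -natr_sum ler_nat sum_card_above -sum1_card leq_sum // => w wB.
  have [phiw /setIidPl->] := phi_unif (subsetP BA w wB).
  by rewrite phiw.
move=> h; apply: (le_lt_trans h).
have : \sum_(u in Y) #|above B phi [set u]|%:R <= \sum_(u in Y) (E / (8 * N)).
  by apply: ler_sum => u uY; have := poor u; rewrite uY /= -ltNge => /ltW.
rewrite sumr_const -[X in _ <= X]mulr_natl.
have : #|Y|%:R * (E / (8 * N)) <= N * (E / (8 * N)).
  by apply: ler_wpM2r => //; pos.
have -> : N * (E / (8 * N)) = E / 8 by field; rewrite gt_eqF.
by move: E0; lra.
Qed.

Lemma step_inv_reject B A1 phi1 S Z u : step_inv B A1 phi1 S Z -> u \in Y ->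
  step_inv (B :\: above B phi [set u]) A1 phi1 S (u |: Z).
Proof.
case=> lk sub disj avoid unsat cover deg ge le ZY uY; split=> //.
- exact: subset_trans (subsetDl _ _) sub.
- by apply: disjointWl disj; exact: subsetDl.
- move=> w; rewrite !inE sub1set => /andP[+ wB]; rewrite wB /= => uw.
  by rewrite setUCA disjointsU1r uw avoid.
- by move=> w T; rewrite inE => /andP[_ wB]; exact: unsat.
- move=> w wA; rewrite !inE sub1set negb_and negbK.
  case: (boolP (w \in B)) => wB /=.
    by rewrite orbF => uw; left; rewrite setUCA disjointsU1r uw.
  move=> _; have [dj|] := cover w wA wB; last by right.
  by left; rewrite setUCA disjointsU1r negb_and dj orbT.
- by rewrite subUset sub1set uY.
Qed.

Section Accept.
Variables (B A1 : {set Om}) (phi1 : Om -> {set X}) (S Z : {set X}) (u : X).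
Hypothesis inv : step_inv B A1 phi1 S Z.
Let L := above B phi [set u].
Definition acc_idx := A1 :|: L.
Definition acc_map w := if w \in L then phi w :\ u else phi1 w.
Definition acc_left :=
  [set w in B :\: L | [forall T : {set X}, (T \subset phi w) ==>
                         ~~ saturated acc_idx acc_map T]].

Let inL w : (w \in L) = (w \in B) && (u \in phi w).
Proof. by rewrite inE sub1set. Qed.

Let L_A1 w : w \in A1 -> w \notin L.
Proof.
move=> wA1; rewrite inL negb_and.
by rewrite (disjointFl (si_disj inv) wA1).
Qed.

Let above_acc T : above acc_idx acc_map T =
  above A1 phi1 T :|: above L (fun w => phi w :\ u) T.
Proof.
apply/setP => w; rewrite in_setU (in_above acc_idx) (in_above A1) (in_above L).
rewrite /acc_idx in_setU /acc_map.
have [wL|wL] := boolP (w \in L); last by rewrite !orbF.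
have /negPf-> : w \notin A1 by apply: contraL wL => /L_A1.
by rewrite orbT.
Qed.

Let sat_mono T : saturated A1 phi1 T -> saturated acc_idx acc_map T.
Proof.
case/andP=> Tn0 h; rewrite /saturated Tn0 /=; apply: (lt_le_trans h).
apply: ler_wpM2l => //; rewrite ler_nat above_acc.
by rewrite subset_leq_card // subsetUl.
Qed.

(** If T gains an edge, that edge lay in B, so T was unsaturated and had used at most half of
    [D #|T|]. The gain is at most the codegree of [u |: T] in A, whose extra factor t keeps it below
    the other half. *)
Let acc_deg T : T != set0 -> #|above acc_idx acc_map T|%:R <= D #|T|.
Proof.
move=> Tn0; rewrite above_acc.
set M := above L _ T.
have [M0|/set0Pn[w0]] := eqVneq M set0.
  by rewrite M0 setU0 (si_deg inv).
rewrite (in_above L) inL => /andP[/andP[w0B uw0]]; rewrite subsetD1 => /andP[Tw0 uT].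
have := si_unsat inv w0B Tw0; rewrite /saturated Tn0 /= -leNgt => h1.
have h2 : #|M|%:R <= D #|T| / 2.
  apply: (@le_trans _ _ (#|above A phi (u |: T)|%:R)).
    rewrite ler_nat subset_leq_card //; apply/subsetP => w.
    rewrite (in_above L) in_above inL => /andP[/andP[wB uw]]; rewrite subsetD1 => /andP[Tw _].
    by rewrite (subsetP (si_sub inv)) //= subUset sub1set uw.
  apply: (le_trans (codeg _)).
    by rewrite -card_gt0 cardsU1 uT.
  rewrite cardsU1 uT add1n /= /D.
  have [k ->] : exists k, #|T| = k.+1.
    by exists #|T|.-1; rewrite prednK // card_gt0.
  rewrite /= exprS.
  have -> : link_const * t ^+ k * (b%:R * E / (8 * N)) / N / 2 =
     4 * K * (2 ^+ r * K) * (t * t ^+ k) * E / N.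
    by rewrite /link_const /t; field; rewrite gt_eqF.
  apply: ler_wpM2r; first pos.
  apply: ler_wpM2r; first pos.
  apply: ler_wpM2r; first by pos.
  have h : 1 <= 2 ^+ r * K :> R.
    by rewrite -[leLHS]mulr1 ler_pM // exprn_ege1 // ler1n.
  have : K * 1 <= K * (2 ^+ r * K) by rewrite ler_pM2l.
  by move: K0; nra.
have h3 : #|above A1 phi1 T :|: M|%:R <= #|above A1 phi1 T|%:R + #|M|%:R :> R.
  by rewrite -natrD ler_nat leq_card_setU.
by move: h1 h2 h3; lra.
Qed.

Lemma step_inv_accept : u \in Y -> u \notin S ->
  E / (8 * N) <= #|L|%:R -> step_inv acc_left acc_idx acc_map (u |: S) Z.
Proof.
move=> uY uS Lge; have LB w : w \in L -> w \in B by rewrite inL => /andP[].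
have [A1A lk] := si_link inv; have BA := subsetP (si_sub inv).
have cSu : #|u |: S| = #|S|.+1 by rewrite cardsU1 uS.
have eS : #|S|.+1%:R = #|S|%:R + 1 :> R by rewrite -addn1 natrD.
have dAL : #|acc_idx| = (#|A1| + #|L|)%N.
  rewrite cardsU; suff -> : A1 :&: L = set0 by rewrite cards0 subn0.
  by apply/setP => w; rewrite in_setI in_set0; apply/negP => /andP[/L_A1/negP].
split.
- split.
    by rewrite subUset A1A; apply/subsetP => w /LB/BA.
  move=> w; rewrite in_setU /acc_map; have [wL _|wL] := boolP (w \in L).
    by exists u; rewrite ?setU11 //; move: wL; rewrite inL => /andP[].
  rewrite orbF => /lk[v vS [vw e]]; exists v => //.
  by rewrite in_setU1 vS orbT.
- by apply/subsetP => w; rewrite in_set in_setD => /andP[/andP[_ /BA]].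
- rewrite disjoints_subset; apply/subsetP => w.
  rewrite in_set in_setD in_setC in_setU => /andP[/andP[wL wB] _].
  by rewrite (negPf wL) orbF (disjointFr (si_disj inv) wB).
- move=> w; rewrite in_set in_setD inL => /andP[/andP[+ wB] _].
  by rewrite wB /= -setUA disjointsU1r => ->; exact: (si_avoid inv).
- by move=> w T; rewrite in_set => /andP[_ /forallP/(_ T)/implyP].
- move=> w wA; rewrite in_set in_setD.
  have [wL _|wL] := boolP (w \in L).
    left; rewrite -setUA disjointsU1r negb_and negbK.
    by move: wL; rewrite inL => /andP[_ ->].
  have [wB|wB] := boolP (w \in B) => /= h.
    right; move: h; rewrite negb_forall => /existsP[T].
    by rewrite negb_imply negbK => /andP[Tw sT]; exists T.
  have [dj|[T sT Tw]] := si_cover inv wA wB.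
    by left; rewrite -setUA disjointsU1r negb_and dj orbT.
  by right; exists T => //; exact: sat_mono.
- exact: acc_deg.
- have := si_ge inv; rewrite dAL cSu eS (natrD _ #|A1|).
  have -> : (#|S|%:R + 1) * E / (8 * N) = #|S|%:R * E / (8 * N) + E / (8 * N).
    by field; rewrite gt_eqF.
  by move: Lge; lra.
- have := si_le inv; rewrite dAL cSu eS (natrD _ #|A1|).
  have -> : (#|S|%:R + 1) * K * E / N = #|S|%:R * K * E / N + K * E / N.
    by field; rewrite gt_eqF.
  have : #|L|%:R <= K * E / N.
    apply: le_trans (deg1 u); rewrite ler_nat subset_leq_card //.
    by apply/subsetP => w; rewrite inL in_above sub1set => /andP[/BA-> ->].
  lra.
- exact: si_Z inv.
Qed.

End Accept.

(* The function g answers only from the fingerprint S, although the scan queries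
   membership in I: a queried vertex lies in I exactly when it enters S. *)
Definition step_outcome I S (o : {set X} + {set Om} * (Om -> {set X})) :=
  match o with
  | inl Z => [/\ N / (4 * K) <= #|Z|%:R, Z \subset Y & [disjoint Z & I]]
  | inr (A1, phi1) => [/\ link_of A1 phi1 S,
      b%:R * E / (8 * N) <= #|A1|%:R &
      forall T, T != set0 -> #|above A1 phi1 T|%:R <= D #|T|]
  end.

(** Induction on |B|: whichever way the query about the rich vertex [u] is answered, the edges
    through [u] leave B. *)
Lemma container_step_from B A1 phi1 S Z : step_inv B A1 phi1 S Z ->
  (#|S| <= b)%N ->
  exists g, forall I, [disjoint Z & I] -> S \subset I ->
  exists S', [/\ S \subset S', S' \subset I, (#|S'| <= b)%N &
                 step_outcome I S' (g S')].
Proof.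
have [k] := ubnP #|B|; elim: k => // k IHk in B A1 phi1 S Z *.
rewrite ltnS => Bk inv Sb.
have [Zbig|Zsmall] := leP (N / (4 * K)) #|Z|%:R.
  exists (fun _ => inl Z) => I ZI SI; exists S; split => //.
  by split => //; exact: si_Z inv.
have [Sb'|Sb'] := eqVneq #|S| b.
  exists (fun _ => inr (A1, phi1)) => I ZI SI; exists S; split => //; split.
  - exact: si_link inv.
  - by rewrite -Sb'; exact: si_ge inv.
  - exact: si_deg inv.
have Sltb : (#|S| < b)%N by rewrite ltn_neqAle Sb' Sb.
have Bbig := remaining_large inv Sb (ltW Zsmall).
have [u uY rich] := rich_vertex (si_sub inv) Bbig.
have L0 : (0 < #|above B phi [set u]|)%N.
  by rewrite -(ltr0n R); apply: lt_le_trans rich; pos.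
have Bdec : (#|B :\: above B phi [set u]| < k)%N.
  apply: leq_trans Bk; rewrite -(cardsID (above B phi [set u]) B) -add1n leq_add2r.
  suff -> : B :&: above B phi [set u] = above B phi [set u] by [].
  by apply/setIidPr/subsetP => w; rewrite in_above => /andP[].
have [w0] := card_gt0P L0; rewrite in_above sub1set => /andP[w0B uw0].
have /negP uSZ : u \notin S :|: Z.
  by rewrite (disjointFr (si_avoid inv w0B) uw0).
have uS : u \notin S by apply/negP => h; apply: uSZ; rewrite in_setU h.
have k1 : (#|acc_left B A1 phi1 u| < k)%N.
  apply: leq_ltn_trans Bdec; apply: subset_leq_card; apply/subsetP => w.
  by rewrite in_set => /andP[].
have Sb1 : (#|u |: S| <= b)%N by rewrite cardsU1 uS add1n.
have [g1 Hg1] := IHk _ _ _ _ _ k1 (step_inv_accept inv uY uS rich) Sb1.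
have [g0 Hg0] := IHk _ _ _ _ _ Bdec (step_inv_reject inv uY) Sb.
(* [u] depends on the state only, so both continuations exist before I is given. S only grows and
   stays inside I, so the final fingerprint contains [u] exactly when I does. *)
exists (fun S' => if u \in S' then g1 S' else g0 S') => I ZI SI.
have [uI|uI] := boolP (u \in I).
  have [//||S' [S1 S2 S3 S4]] := Hg1 I.
    by rewrite subUset sub1set uI.
  exists S'; split => //; last by rewrite (subsetP S1) ?setU11.
  by apply: subset_trans S1; exact: subsetUr.
have ZuI : [disjoint u |: Z & I] by rewrite disjoint_sym disjointsU1r uI disjoint_sym.
have [S' [S1 S2 S3 S4]] := Hg0 I ZuI SI.
exists S'; split => //.
by rewrite (negPf (contra (subsetP S2 u) uI)).
Qed.

Lemma container_step : exists g, forall I,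
  exists S, [/\ S \subset I, (#|S| <= b)%N & step_outcome I S (g S)].
Proof.
have inv : step_inv A set0 phi set0 set0.
  have above0 T : above set0 phi T = set0.
    by apply/setP => w; rewrite in_above in_set0.
  split; rewrite ?sub0set ?cards0 ?mul0r ?disjoint_setI0 //.
  - by split; rewrite ?sub0set // => w; rewrite in_set0.
  - by rewrite -setI_eq0 setI0.
  - by move=> w _; rewrite setU0 -setI_eq0 setI0.
  - move=> w T _ _; rewrite /saturated above0 cards0 mulr0 negb_and -leNgt.
    by rewrite ltW ?orbT.
  - by move=> w ->.
  - by move=> T _; rewrite above0 cards0 ltW.
have [|g Hg] := container_step_from inv; first by rewrite cards0.
exists g => I; have [||S [_ S1 S2 S3]] := Hg I; rewrite ?sub0set //.
  by rewrite -setI_eq0 set0I.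
by exists S.
Qed.

End ContainerStep.

(* Sets I spanning few edges, not only independent ones, are covered: vertices of I
   of large degree within I (at most b of them at each of the r levels) are given
   up, which is why f l is only almost disjoint from I. *)
Lemma containers (R : realType) (r : nat) (K : R) : 1 <= K ->
  exists2 c : R, 0 < c & exists2 xi : R, 0 < xi &
  forall (X Om : finType) (b : nat) (N : R) (A : {set Om})
    (phi : Om -> {set X}) (Y : {set X}),
  0 < N -> (0 < b)%N -> b%:R <= c * N -> #|Y|%:R <= N -> (0 < #|A|)%N ->
  (forall w, w \in A -> #|phi w| = r /\ phi w \subset Y) ->
  (forall T, T != set0 ->
     #|above A phi T|%:R <= K * (b%:R / N) ^+ #|T|.-1 * #|A|%:R / N) ->
  exists f : seq {set X} -> {set X}, forall I,
    #|within A phi I|%:R <= xi * (b%:R / N) ^+ r * #|A|%:R ->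
    exists l, [/\ size l = r,
      forall S : {set X}, S \in l -> S \subset I /\ (#|S| <= b)%N,
      c * N <= #|f l|%:R, f l \subset Y & (#|I :&: f l| <= r * b)%N].
Proof.
elim: r K => [|r IHr] K K1.
  (* All edges of a 0-uniform hypergraph are empty and lie within every I, so a proportion of 1/2 is
     impossible and the claim is vacuous. *)
  exists 1 => //; exists 2^-1 => [|X Om b N A phi Y N0 b0 bN YN A0 unif _]; first pos.
  exists (fun _ => set0) => I; rewrite expr0 mulr1.
  suff -> : within A phi I = A.
    by have : (0 : R) < #|A|%:R by [rewrite ltr0n]; lra.
  apply/setP => w; rewrite in_within; case: (boolP (w \in A)) => //= wA.
  have [/eqP + _] := unif w wA.
  by rewrite cards_eq0 => /eqP->; rewrite sub0set.
have K0 : 0 < K by apply: lt_le_trans K1.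
pose K' := link_const r K.
have K'1 : 1 <= K'.
  have h1 : 1 <= 2 ^+ r :> R by rewrite exprn_ege1 // ler1n.
  have h2 : 1 <= K ^+ 2 by rewrite exprn_ege1.
  by rewrite /K' /link_const; nra.
have [c' c'0 [xi' xi'0 IH]] := IHr K' K'1.
pose c := Num.min c' (4 * K)^-1.
have c0 : 0 < c by rewrite /c lt_min c'0 invr_gt0 mulr_gt0.
(* Chosen to make [b * th] below equal to xi' t^r times b E / (8N), the guaranteed size of the link
   hypergraph. *)
pose xi := xi' / (8 * r.+1%:R).
have xi0 : 0 < xi by rewrite /xi; pos.
exists c => //; exists xi => // X Om b N A phi Y N0 b0 bcN YN A0 unif codeg.
have bN : b%:R <= N / (4 * K).
  apply: (le_trans bcN); rewrite mulrC ler_pM2l //.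
  by rewrite /c ge_min lexx orbT.
have bc'N : b%:R <= c' * N.
  by apply: (le_trans bcN); rewrite ler_pM2r // /c ge_min lexx.
set E := #|A|%:R : R in codeg *; set t := b%:R / N in codeg *.
have bR0 : 0 < b%:R :> R by rewrite ltr0n.
have t0 : 0 < t by rewrite /t; pos.
have E0 : 0 < E by rewrite ltr0n.
have [g Hg] := container_step K1 N0 b0 bN YN A0 unif codeg.
(* The function for the link must be fixed before I is known, hence a choice over all possible
   outcomes; unattained ones get a dummy value. *)
pose good (o : {set Om} * (Om -> {set X})) (f : seq {set X} -> {set X}) :=
  (exists I S, step_outcome r b K N A phi Y I S (inr o)) ->
  forall I, #|within o.1 o.2 I|%:R <= xi' * t ^+ r * #|o.1|%:R ->
    exists l, [/\ size l = r,
      forall S : {set X}, S \in l -> S \subset I /\ (#|S| <= b)%N,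
      c' * N <= #|f l|%:R, f l \subset Y & (#|I :&: f l| <= r * b)%N].
have /boolp.choice[fo Hfo] : forall o, exists f, good o f.
  move=> -[A1 phi1]; rewrite /good /=.
  have [[I0 [S0 [lk A1ge deg]]]|no] := pselect (exists I S,
    step_outcome r b K N A phi Y I S (inr (A1, phi1))); last by exists (fun _ => set0).
  have [A1A lk1] := lk.
  have A10 : (0 < #|A1|)%N.
    by rewrite -(ltr0n R); apply: lt_le_trans A1ge; pos.
  have unif1 w : w \in A1 -> #|phi1 w| = r /\ phi1 w \subset Y.
    move=> wA1; have [u uS [uw ->]] := lk1 w wA1.
    have [] := unif w (subsetP A1A w wA1).
    rewrite (cardsD1 u) uw add1n => -[-> wY]; split => //.
    by apply: subset_trans wY; exact: subsetDl.
  have [|f Hf] := IH X Om b N A1 phi1 Y N0 b0 bc'N YN A10 unif1.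
    move=> T Tn0; apply: (le_trans (deg T Tn0)).
    apply: ler_wpM2r; first pos.
    apply: ler_wpM2l => //; rewrite mulr_ge0 ?exprn_ge0 //; last exact: ltW.
    by apply: le_trans K'1.
  by exists f => _; exact: Hf.
exists (fun l => if l is S0 :: l' then
           match g S0 with inl Z => Z | inr o => fo o l' end else set0).
move=> I few.
pose W := within A phi I.
(* Degrees within I add up to (r + 1)|W| <= [b * th], so at most b vertices exceed [th]. After their
   removal, a fingerprint of at most b vertices has at most [b * th] link edges within I'. *)
pose th := r.+1%:R * xi * t ^+ r.+1 * E / b%:R.
have th0 : 0 < th by rewrite /th; pos.
pose bad := [set v in I | th < #|above W phi [set v]|%:R].
have bad_le : (#|bad| <= b)%N.
  rewrite -(ler_nat R) -(ler_pM2r th0).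
  have -> : b%:R * th = r.+1%:R * (xi * t ^+ r.+1 * E).
    by rewrite /th; field; rewrite gt_eqF.
  apply: (@le_trans _ _ (r.+1%:R * #|W|%:R)); last by rewrite ler_pM2l.
  apply: (@le_trans _ _ (\sum_(v in I) #|above W phi [set v]|%:R)).
    rewrite (bigID (mem bad)) /= -[leLHS]addr0 lerD ?sumr_ge0 //.
    rewrite -sum1_card natr_sum mulr_suml.
    rewrite (eq_bigl (fun v => v \in bad)); last first.
      by move=> v; rewrite andbC; case: (boolP (v \in bad)) => //; rewrite in_set => /andP[].
    by apply: ler_sum => v; rewrite in_set mul1r => /andP[_ /ltW].
  rewrite -natr_sum -natrM ler_nat sum_card_above.
  rewrite (eq_bigr (fun _ => r.+1)); first by rewrite sum_nat_const mulnC.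
  move=> w; rewrite in_within => /andP[wA /setIidPl->].
  by have [] := unif w wA.
pose I' := I :\: bad.
have I'I : I' \subset I by exact: subsetDl.
have [S [SI' Sb out]] := Hg I'.
have lose Z k : (#|I' :&: Z| <= k * b)%N -> (#|I :&: Z| <= k.+1 * b)%N.
  move=> h; rewrite -(cardsID bad (I :&: Z)) mulSn.
  apply: leq_add.
    by apply: leq_trans bad_le; rewrite subset_leq_card // subsetIr.
  apply: leq_trans h; rewrite subset_leq_card //; apply/subsetP => v.
  by rewrite !inE => /andP[-> /andP[-> ->]].
have padS : {subset nseq r set0 <= [pred S : {set X} | S == set0]}.
  by move=> S' /nseqP[-> _] /=; rewrite inE.
case E1 : (g S) => [Z|o]; rewrite E1 in out.
  (* The large set Z was found early; empty sets pad the fingerprint to the common length. *)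
  exists (S :: nseq r set0); rewrite E1; split.
  - by rewrite /= size_nseq.
  - move=> S'; rewrite inE => /orP[/eqP->|/padS].
      by split => //; exact: subset_trans I'I.
    by rewrite inE => /eqP->; rewrite sub0set cards0.
  - case: out => + _ _; apply: le_trans.
    by rewrite mulrC ler_pM2l // /c ge_min lexx orbT.
  - by case: out.
  - apply: lose; case: out => _ _ /disjoint_setI0.
    by rewrite setIC => ->; rewrite cards0.
have [l [sl lS cf fY lose']] : exists l, [/\ size l = r,
    forall S : {set X}, S \in l -> S \subset I' /\ (#|S| <= b)%N,
    c' * N <= #|fo o l|%:R, fo o l \subset Y & (#|I' :&: fo o l| <= r * b)%N].
  apply: Hfo; first by exists I', S.
  case: o E1 out => A1 phi1 E1 [[A1A lk] A1ge _] /=.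
  have : #|within A1 phi1 I'|%:R <= b%:R * th.
    apply: (@le_trans _ _ (\sum_(u in S) #|above W phi [set u]|%:R)).
      rewrite -natr_sum ler_nat.
      apply: leq_card_cover => w; rewrite in_within => /andP[wA1 wI'].
      have [u uS [uw e]] := lk w wA1; exists u => //.
      rewrite in_above in_within sub1set uw (subsetP A1A) //= andbT.
      rewrite -(setD1K uw) subUset sub1set -e (subset_trans wI') // andbT.
      by apply: (subsetP I'I); apply: (subsetP SI').
    apply: (@le_trans _ _ (\sum_(u in S) th)).
      apply: ler_sum => u /(subsetP SI'); rewrite !inE negb_and -leNgt.
      by case/andP => /orP[/negPf->|].
    by rewrite sumr_const -[X in X <= _]mulr_natl ler_pM2r // ler_nat.
  move/le_trans; apply.
  have -> : b%:R * th = xi' * t ^+ r * (b%:R * E / (8 * N)).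
    rewrite /th /xi exprS /t; field.
    by rewrite addrC natr1 !gt_eqF // ltr0Sn.
  by apply: ler_wpM2l => //; pos.
exists (S :: l); rewrite E1; split => //.
- by rewrite /= sl.
- move=> S'; rewrite inE => /orP[/eqP->|/lS[S'I' S'b]].
    by split => //; exact: subset_trans I'I.
  by split => //; exact: subset_trans I'I.
- apply: le_trans cf; rewrite ler_pM2r // /c ge_min lexx //.
- exact: lose.
Qed.

(** While the current set C spans at least E edges, the hypotheses, stated relative to E, imply
    those of [containers] for the hypergraph inside C. Each round deletes at least [c * N] vertices,
    so more than 1 / c rounds would exhaust Y. *)
Lemma iterated_containers (R : realType) (r : nat) (K : R) :
    (0 < r)%N -> 1 <= K ->
  exists2 c : R, 0 < c & exists2 xi : R, 0 < xi & exists k : nat,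
  forall (X Om : finType) (b : nat) (N E : R) (A : {set Om})
    (phi : Om -> {set X}) (Y : {set X}),
  0 < N -> 0 < E -> (0 < b)%N -> b%:R <= c * N -> #|Y|%:R <= N ->
  (forall w, w \in A -> #|phi w| = r /\ phi w \subset Y) ->
  (forall T, T != set0 ->
     #|above A phi T|%:R <= K * (b%:R / N) ^+ #|T|.-1 * E / N) ->
  exists g : seq {set X} -> {set X}, forall I : {set X}, I \subset Y ->
    #|within A phi I|%:R <= xi * (b%:R / N) ^+ r * E ->
    exists l, [/\ size l = k,
      forall S : {set X}, S \in l -> S \subset I /\ (#|S| <= b)%N,
      g l \subset Y, #|within A phi (g l)|%:R < E & (#|I :\: g l| <= k * b)%N].
Proof.
move=> r0 K1.
have [c c0 [xi xi0 cont]] := containers r K1.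
exists c => //; exists xi => //.
pose J := (Num.truncn c^-1).+1.
exists (J * r)%N => X Om b N E A phi Y N0 E0 b0 bcN YN unif codeg.
have t0 : 0 < b%:R / N by rewrite divr_gt0 // ltr0n.
suff H j (C : {set X}) : C \subset Y -> #|C|%:R <= j%:R * (c * N) ->
    exists g : seq {set X} -> {set X}, forall I : {set X},
    #|within A phi I|%:R <= xi * (b%:R / N) ^+ r * E ->
    exists l, [/\ size l = (j * r)%N,
      forall S : {set X}, S \in l -> S \subset I /\ (#|S| <= b)%N,
      g l \subset C, #|within A phi (g l)|%:R < E &
      (#|(I :&: C) :\: g l| <= j * r * b)%N].
  have [//||g Hg] := H J Y.
    apply: (le_trans YN); rewrite mulrA -[leLHS]mul1r ler_pM2r //.
    rewrite -ler_pdivrMr // div1r; apply: ltW.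
    exact: Num.Theory.truncnS_gt.
  exists g => I /setIidPl IY few; have [l [l1 l2 l3 l4 l5]] := Hg I few.
  by exists l; split => //; rewrite IY in l5.
elim: j C => [|j IHj] C CY.
  rewrite mul0r lern0 cards_eq0 => /eqP->.
  exists (fun _ => set0) => I _; exists [::]; split => //.
    suff -> : within A phi set0 = set0 by rewrite cards0.
    apply/setP => w; rewrite in_within in_set0; apply/negP => /andP[wA].
    rewrite subset0 => /eqP e; have [] := unif w wA.
    by rewrite e cards0 => e'; rewrite -e' in r0.
  by rewrite setI0 set0D cards0.
move=> Cs; have [Csparse|Cdense] := ltP #|within A phi C|%:R E.
  exists (fun _ => C) => I _; exists (nseq (j.+1 * r) set0).
  rewrite size_nseq; split => //.
    by move=> S /nseqP[-> _]; rewrite sub0set cards0.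
  by rewrite setDIl setDv setI0 cards0.
have CN : #|C|%:R <= N.
  by apply: le_trans YN; rewrite ler_nat subset_leq_card.
have AC0 : (0 < #|within A phi C|)%N by rewrite -(ltr0n R); apply: lt_le_trans Cdense.
have unifC w : w \in within A phi C -> #|phi w| = r /\ phi w \subset C.
  by rewrite in_within => /andP[/unif[-> _] ->].
have [|f Hf] := cont X Om b N _ phi C N0 b0 bcN CN AC0 unifC.
  move=> T Tn0; apply: (@le_trans _ _ (#|above A phi T|%:R)).
    rewrite ler_nat subset_leq_card //; apply/subsetP => w.
    by rewrite !in_above in_within => /andP[/andP[-> _] ->].
  apply: (le_trans (codeg T Tn0)); apply: ler_wpM2r; first pos.
  apply: ler_wpM2l => //; rewrite mulr_ge0 ?exprn_ge0 //; last exact: ltW.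
  exact: le_trans K1.
pose good l1 (g : seq {set X} -> {set X}) :=
  c * N <= #|f l1|%:R -> f l1 \subset C -> forall I : {set X},
    #|within A phi I|%:R <= xi * (b%:R / N) ^+ r * E ->
    exists l, [/\ size l = (j * r)%N,
      forall S : {set X}, S \in l -> S \subset I /\ (#|S| <= b)%N,
      g l \subset C :\: f l1, #|within A phi (g l)|%:R < E &
      (#|(I :&: (C :\: f l1)) :\: g l| <= j * r * b)%N].
have /boolp.choice[g Hg] : forall l1, exists g, good l1 g.
  move=> l1; have [[h1 h2]|no] := pselect (c * N <= #|f l1|%:R /\ f l1 \subset C).
    have [||g Hg] := IHj (C :\: f l1); last by exists g => _ _.
      by apply: subset_trans CY; exact: subsetDl.
    rewrite cardsD (setIidPr h2) natrB ?subset_leq_card //.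
    by move: Cs h1; rewrite -natr1 mulrDl mul1r; lra.
  by exists (fun _ => set0) => h1 h2; case: no.
exists (fun l => g (take r l) (drop r l)) => I few.
have [|l1 [sl1 sub1 big1 fC lose1]] := Hf I.
  apply: (@le_trans _ _ (#|within A phi I|%:R)).
    rewrite ler_nat subset_leq_card //; apply/subsetP => w.
    by rewrite !in_within => /andP[/andP[-> _] ->].
  apply: (le_trans few); apply: ler_wpM2l => //.
  by rewrite mulr_ge0 ?exprn_ge0 // ltW.
have [l2 [sl2 sub2 gC gE lose2]] := Hg l1 big1 fC I few.
exists (l1 ++ l2); rewrite (take_size_cat _ sl1) (drop_size_cat _ sl1); split => //.
- by rewrite size_cat sl1 sl2 mulSn.
- by move=> S; rewrite mem_cat => /orP[/sub1|/sub2].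
- by apply: subset_trans gC _; exact: subsetDl.
- rewrite mulSn mulnDl -(cardsID (f l1)); apply: leq_add.
    apply: leq_trans lose1; rewrite subset_leq_card //; apply/subsetP => v.
    by rewrite !inE => /andP[/andP[_ /andP[-> _]] ->].
  apply: leq_trans lose2; rewrite subset_leq_card //; apply/subsetP => v.
  by rewrite !inE => /andP[-> /andP[-> /andP[-> ->]]].
Qed.

(** * Boxes, copies and embedding *)

Section Boxes.
Variables (V T : finType).
Implicit Types (A W : V -> {set T}) (U : {set T}) (C GR : {set {set T}}).
Implicit Types (E : {set {set V}}) (S : {set V}) (v : {ffun V -> T}).

Definition box A : {set {ffun V -> T}} := [set v : {ffun V -> T} | [forall i, v i \in A i]].

Lemma in_box A v : reflect (forall i, v i \in A i) (v \in box A).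
Proof. by rewrite inE; apply: forallP. Qed.

Lemma card_box A : #|box A| = (\prod_i #|A i|)%N.
Proof.
have -> : #|box A| = #|family (fun i => mem (A i))|.
  by apply: eq_card => v; rewrite inE.
by rewrite card_family foldrE big_map big_enum.
Qed.

Definition edge_images E v : {set {set T}} := [set v @: (f : {set V}) | f in E].

Definition copies E S C GR A : {set {ffun V -> T}} :=
  [set v in box A | (edge_images E v \subset C) && (v @: S \in GR)].

Definition pairs_in C U U' : {set T * T} :=
  [set p in setX U U' | [set p.1; p.2] \in C].

Definition nbhd C U x : {set T} := [set y in U | [set x; y] \in C].

Lemma card_pairs_in C U U' : #|pairs_in C U U'| = (\sum_(x in U) #|nbhd C U' x|)%N.
Proof.
rewrite -sum1_card (eq_bigr (fun x => \sum_(y | y \in nbhd C U' x) 1)%N); last first.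
  by move=> x _; rewrite sum1_card.
rewrite pair_big_dep /=; apply: eq_bigl => -[x y].
by rewrite !inE /= andbA.
Qed.

Lemma copies_sub E S C GR A W : (forall i, A i \subset W i) ->
  copies E S C GR A \subset copies E S C GR W.
Proof.
move=> AW; apply/subsetP => v; rewrite !inE => /andP[/forallP vA ->].
by rewrite andbT; apply/forallP => i; exact: subsetP (AW i) _ (vA i).
Qed.

Variable P : V -> {set T}.
Hypothesis disjP : forall i j, i != j -> [disjoint P i & P j].

Lemma part_inj i j x : x \in P i -> x \in P j -> i = j.
Proof.
move=> xi xj; apply/eqP; apply: contraLR xj => /disjP dj.
by rewrite (disjointFr dj xi).
Qed.

Lemma box_inj v : (forall i, v i \in P i) -> injective v.
Proof. by move=> vP i j e; apply: (part_inj (vP i)); rewrite e. Qed.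

(** A hyperedge is the image of S under the map picking its unique vertex in each root part. Other
    coordinates are filled arbitrarily, which requires the non-root sets to be nonempty. *)
Lemma root_edges_le S GR W : partite_hypergraph P S GR ->
  (forall i, i \in S -> W i \subset P i) -> (forall i, i \notin S -> W i != set0) ->
  (#|[set e in GR | e \subset \bigcup_(i in S) W i]| <=
   #|[set v in box W | [set v i | i in S] \in GR]|)%N.
Proof.
move=> part WP Wn0.
apply: leq_trans (leq_imset_card (fun v : {ffun V -> T} => v @: S) _).
apply: subset_leq_card; apply/subsetP => e; rewrite inE => /andP[eGR eW].
have [cS c1] := part e eGR.
have pickT i : exists x, (i \in S -> x \in e :&: P i) /\ x \in W i.
  have [iS|iS] := boolP (i \in S); last first.
    by have /set0Pn[x xW] := Wn0 i iS; exists x.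
  have /cards1P[x ex] := introT eqP (c1 i iS).
  exists x; split; first by rewrite ex set11.
  have : x \in e :&: P i by rewrite ex set11.
  rewrite inE => /andP[/(subsetP eW)/bigcupP[j jS xWj] xP].
  by rewrite (part_inj xP (subsetP (WP j jS) _ xWj)).
have /boolp.choice[h Hh] := pickT.
have hS i : i \in S -> h i \in e /\ h i \in P i.
  by move=> iS; have [/(_ iS)] := Hh i; rewrite inE => /andP[].
have im : finfun h @: S = e.
  apply/eqP; rewrite eqEcard cS card_in_imset ?leqnn ?andbT; last first.
    move=> i j iS jS; rewrite !ffunE => eij.
    by apply: (part_inj (proj2 (hS i iS))); rewrite eij; case: (hS j jS).
  by apply/subsetP => _ /imsetP[i iS ->]; rewrite ffunE; case: (hS i iS).
apply/imsetP; exists (finfun h) => //; rewrite inE im eGR andbT.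
by apply/in_box => i; rewrite ffunE; have [] := Hh i.
Qed.

End Boxes.

Section Embedding.
Variables (R : realType) (V T : finType) (P : V -> {set T}).
Variables (E : {set {set V}}) (S : {set V}) (C GR : {set {set T}}).
Variables (delta s rho : R) (A : V -> {set T}).
Implicit Types (L : {set V}) (W : V -> {set T}) (U : {set T}).
(** Each embedded vertex shrinks candidate sets by a factor delta at worst, so proportion [dv]
    always survives. [eps] makes |V| exceptional sets of proportion [eps] fill only half of that,
    and [eta] is the other half. *)
Let dv := delta ^+ #|V|.
Let eps := dv / (2 * #|V|%:R).
Let eta := dv / 2.
Hypotheses (disjP : forall i j, i != j -> [disjoint P i & P j])
  (simpE : simple_graph E) (ES : forall f, f \in E -> ~~ (f \subset S))
  (d0 : 0 < delta) (d1 : delta <= 1) (rho0 : 0 <= rho)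
  (AP : forall i, A i \subset P i) (An0 : forall i, A i != set0)
  (part : partite_hypergraph P S GR)
  (As : forall i, s <= dv * #|A i|%:R).
Hypothesis roots_low : forall W,
  (forall i, i \in S -> W i \subset P i /\ s <= #|W i|%:R) ->
  rho * \prod_(i in S) #|W i|%:R <=
    #|[set e in GR | e \subset \bigcup_(i in S) W i]|%:R.
Hypothesis dense : forall i j U U', [set i; j] \in E ->
  U \subset A i -> U' \subset A j ->
  eps * #|A i|%:R <= #|U|%:R -> eps * #|A j|%:R <= #|U'|%:R ->
  delta * (#|U|%:R * #|U'|%:R) < #|pairs_in C U U'|%:R.

Let dv0 : 0 < dv. Proof. exact: exprn_gt0. Qed.
Let dv1 : dv <= 1. Proof. by rewrite exprn_ile1 // ltW. Qed.
Let dv_le e : (e <= #|V|)%N -> dv <= delta ^+ e.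
Proof. by move=> eV; rewrite ler_wiXn2l // ltW. Qed.

Section Extend.
Variables (L : {set V}) (W : V -> {set T}) (e : nat) (l : V).
Hypotheses (lL : l \in L) (LS : L \subset ~: S) (eV : (e < #|V|)%N).
Hypothesis W_large : forall i, i \in L :|: S ->
  W i \subset A i /\ delta ^+ e * #|A i|%:R <= #|W i|%:R.
Hypothesis W_n0 : forall i, i \notin L :|: S -> W i != set0.
Hypothesis W_done : forall i j x y, [set i; j] \in E -> i \notin L :|: S ->
  x \in W i -> y \in W j -> [set x; y] \in C.

Definition rich_vertices := [set x in W l |
  `[< forall j, j \in L :|: S -> [set l; j] \in E ->
        delta * #|W j|%:R <= #|nbhd C (W j) x|%:R >]].

Definition shrink x i := if i == l then [set x] else
  if (i \in L :|: S) && ([set l; i] \in E) then nbhd C (W i) x else W i.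

Let lLS : l \in L :|: S. Proof. by rewrite inE lL. Qed.

(** For a neighbour j of l, the vertices of [W l] with too few neighbours in [W j] would form a
    sparse pair with [W j]; by [dense] they have proportion less than [eps]. *)
Lemma card_rich : eta * #|A l|%:R <= #|rich_vertices|%:R.
Proof.
pose bad j := [set x in W l | #|nbhd C (W j) x|%:R < delta * #|W j|%:R].
have [Wl Wls] := W_large lLS.
have V0 : 0 < #|V|%:R :> R by rewrite ltr0n; apply: leq_ltn_trans eV.
have badle j : (j \in L :|: S) && ([set l; j] \in E) ->
    #|bad j|%:R <= eps * #|A l|%:R.
  case/andP=> jLS lj; have [Wj Wjs] := W_large jLS.
  have badW : bad j \subset W l by apply/subsetP => x; rewrite inE => /andP[].
  rewrite leNgt; apply/negP => big.
  have epsd : eps <= delta ^+ e.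
    apply: le_trans (dv_le (ltnW eV)); rewrite /eps ler_pdivrMr ?mulr_gt0 //.
    rewrite -[leLHS]mulr1 ler_pM2l //.
    have : 1 <= #|V|%:R :> R by rewrite ler1n -(ltr0n R).
    lra.
  have := dense lj (subset_trans badW Wl) Wj (ltW big) _.
  have /[swap]/[apply] : eps * #|A j|%:R <= #|W j|%:R.
    by apply: le_trans Wjs; rewrite ler_wpM2r.
  rewrite card_pairs_in natr_sum ltNge => /negP; apply.
  apply: (@le_trans _ _ (\sum_(x in bad j) (delta * #|W j|%:R))).
    by apply: ler_sum => x; rewrite inE => /andP[_ /ltW].
  by rewrite sumr_const -[X in X <= _]mulr_natl mulrCA.
have cov : (#|W l| <= #|rich_vertices| +
    \sum_(j | (j \in L :|: S) && ([set l; j] \in E)) #|bad j|)%N.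
  rewrite -(cardsID rich_vertices (W l)); apply: leq_add.
    by rewrite subset_leq_card // subsetIr.
  apply: leq_card_cover => x; rewrite !inE => /andP[+ xW].
  rewrite xW /= => /asboolPn/existsNP[j /not_implyP[jLS /not_implyP[lj]]].
  move/negP; rewrite -ltNge => h.
  by exists j; [rewrite jLS | rewrite inE xW].
have : #|W l|%:R <= #|rich_vertices|%:R + #|V|%:R * (eps * #|A l|%:R).
  move: cov; rewrite -(ler_nat R) natrD => /le_trans; apply; rewrite lerD2l.
  rewrite natr_sum; apply: (le_trans (ler_sum _ badle)).
  rewrite sumr_const -[X in X <= _]mulr_natl ler_wpM2r ?ler_nat ?max_card //.
  by rewrite mulr_ge0 // /eps divr_ge0 ?mulr_ge0 // ltW.
have -> : #|V|%:R * (eps * #|A l|%:R) = eta * #|A l|%:R.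
  by rewrite /eps /eta; field; rewrite gt_eqF.
have : dv * #|A l|%:R <= #|W l|%:R.
  by apply: le_trans Wls; rewrite ler_wpM2r // dv_le // ltnW.
have -> : dv = 2 * eta by rewrite /eta; field.
lra.
Qed.

Lemma shrink_sub x i : x \in W l -> shrink x i \subset W i.
Proof.
move=> xW; rewrite /shrink; case: eqP => [->|_]; first by rewrite sub1set.
by case: ifP => // _; apply/subsetP => y; rewrite inE => /andP[].
Qed.

Lemma shrink_large x i : x \in rich_vertices -> i \in (L :\ l) :|: S ->
  shrink x i \subset A i /\ delta ^+ e.+1 * #|A i|%:R <= #|shrink x i|%:R.
Proof.
rewrite inE => /andP[xW /asboolP rich] iL.
have iLS : i \in L :|: S.
  by move: iL; rewrite !inE => /orP[/andP[_ ->]|->]; rewrite ?orbT.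
have [Wi Wis] := W_large iLS.
split; first by apply: subset_trans Wi; exact: shrink_sub.
have il : i != l.
  move: iL; rewrite !inE => /orP[/andP[]//|iS].
  by apply: contraL iS => /eqP->; have := subsetP LS _ lL; rewrite inE.
rewrite /shrink (negPf il) iLS /= exprS -mulrA; case: ifP => li.
  apply: le_trans (rich i iLS li).
  by rewrite ler_pM2l.
apply: le_trans Wis; rewrite -[leRHS]mul1r ler_wpM2r //.
by rewrite mulr_ge0 // exprn_ge0 // ltW.
Qed.

Lemma shrink_n0 x i : x \in rich_vertices -> i \notin (L :\ l) :|: S ->
  shrink x i != set0.
Proof.
move=> _ iL; rewrite /shrink; case: (eqVneq i l) => [_|il].
  by rewrite -card_gt0 cards1.
have iLS : i \notin L :|: S by move: iL; rewrite !inE il.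
by rewrite (negPf iLS) W_n0.
Qed.

Lemma shrink_done x i j y z : x \in rich_vertices -> [set i; j] \in E ->
  i \notin (L :\ l) :|: S -> y \in shrink x i -> z \in shrink x j ->
  [set y; z] \in C.
Proof.
rewrite inE => /andP[xW _] ij iL yi zj.
have zW := subsetP (shrink_sub j xW) _ zj.
have [il|il] := eqVneq i l; last first.
  have iLS : i \notin L :|: S by move: iL; rewrite !inE il.
  by apply: (W_done ij iLS _ zW); exact: (subsetP (shrink_sub i xW)).
move: yi; rewrite {1}/shrink il eqxx inE => /eqP->.
have jl : j != l.
  apply/eqP => jl; have := simpE ij; rewrite il jl setUid cards1.
  by [].
have [jLS|jLS] := boolP (j \in L :|: S).
  by move: zj; rewrite /shrink (negPf jl) jLS -il ij /= inE => /andP[].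
by rewrite setUC; apply: (W_done _ jLS zW xW); rewrite setUC -il.
Qed.

End Extend.

(* L is the set of non-root vertices still to be embedded; the images of the other
   non-root vertices are represented by W i being a set all of whose elements are
   admissible. *)
Lemma embedding_from k L W e : #|L| = k -> L \subset ~: S ->
  (e + k <= #|V|)%N ->
  (forall i, i \in L :|: S ->
     W i \subset A i /\ delta ^+ e * #|A i|%:R <= #|W i|%:R) ->
  (forall i, i \notin L :|: S -> W i != set0) ->
  (forall i j x y, [set i; j] \in E -> i \notin L :|: S ->
     x \in W i -> y \in W j -> [set x; y] \in C) ->
  rho * \prod_(i in L :|: S) (eta * #|A i|%:R) <= #|copies E S C GR W|%:R.
Proof.
elim: k => [|k IHk] in L W e *.
  move/cards0_eq => -> _; rewrite addn0 set0U => eV W1 W2 W3.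
  have Wge i : i \in S -> dv * #|A i|%:R <= #|W i|%:R.
    by move=> /W1[_]; apply: le_trans; rewrite ler_wpM2r // dv_le.
  apply: (@le_trans _ _ (rho * \prod_(i in S) #|W i|%:R)).
    rewrite ler_wpM2l // ler_prod // => i iS; apply/andP; split.
      by rewrite mulr_ge0 // divr_ge0 // ltW.
    by apply: le_trans (Wge i iS); rewrite ler_wpM2r // /eta; move: dv0; lra.
  apply: (le_trans (roots_low _)).
    move=> i iS; split; last by apply: le_trans (As i) (Wge i iS).
    by have [Wi _] := W1 i iS; apply: subset_trans (AP i).
  rewrite ler_nat; apply: leq_trans (root_edges_le disjP part _ W2) _.
    by move=> i iS; have [Wi _] := W1 i iS; apply: subset_trans (AP i).
  apply: subset_leq_card; apply/subsetP => v; rewrite !inE => /andP[vW ->].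
  rewrite vW andbT /=; apply/subsetP => _ /imsetP[f fE ->].
  (* Every edge has an endpoint outside of S, and all such vertices are embedded by now, so [W3]
     puts its image into C. *)
  have [i [j [fij iS]]] : exists i j, f = [set i; j] /\ i \notin S.
    have /subsetPn[i fi iS] := ES fE.
    have /eqP/cards2P[a [b [_ fab]]] := simpE fE.
    move: fi; rewrite fab !inE => /orP[]/eqP e'.
      by exists i, b; rewrite -e'.
    by exists i, a; rewrite setUC -e'.
  rewrite fij imsetU1 imset_set1; apply: (W3 i j) => //; first by rewrite -fij.
    exact: (forallP vW).
  exact: (forallP vW).
move=> Lk LS eV W1 W2 W3.
have [l lL] : exists l, l \in L by apply/set0Pn; rewrite -card_gt0 Lk.
have lS : l \notin S by have := subsetP LS _ lL; rewrite inE.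
have eV' : (e < #|V|)%N by apply: leq_trans eV; rewrite addnS ltnS leq_addr.
have Lk' : #|L :\ l| = k by move: Lk; rewrite (cardsD1 l) lL => -[].
have LS' : L :\ l \subset ~: S by apply: subset_trans LS; exact: subD1set.
have step x : x \in rich_vertices L W l ->
    rho * \prod_(i in (L :\ l) :|: S) (eta * #|A i|%:R) <=
    #|copies E S C GR (shrink L W l x)|%:R.
  move=> xr; apply: (IHk (L :\ l) _ e.+1) => //; first by rewrite addSnnS.
  - by move=> i; apply: shrink_large.
  - by move=> i; apply: shrink_n0 xr.
  - by move=> i j y z; apply: shrink_done xr.
apply: (@le_trans _ _ (\sum_(x in rich_vertices L W l)
    #|copies E S C GR (shrink L W l x)|%:R)).
  apply: le_trans (ler_sum _ step).
  rewrite sumr_const -[leRHS]mulr_natl (bigD1 l) /=; last by rewrite inE lL.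
  have -> : \prod_(i in L :|: S | i != l) (eta * #|A i|%:R) =
            \prod_(i in (L :\ l) :|: S) (eta * #|A i|%:R).
    apply: eq_bigl => i; rewrite !inE; case: (eqVneq i l) => [->|] /=.
      by rewrite andbF (negPf lS).
    by rewrite andbT.
  rewrite mulrCA; apply: ler_wpM2r; last exact: (card_rich lL eV').
  rewrite mulr_ge0 // prodr_ge0 // => i _.
  by rewrite mulr_ge0 // divr_ge0 // ltW.
rewrite -natr_sum ler_nat.
(* Copies are classified by their value at l; those obtained from [shrink] by x take the value x
   there, so nothing is counted twice. *)
rewrite -[leqRHS]sum1_card (partition_big (fun v : {ffun V -> T} => v l) predT) //=.
rewrite [leqRHS](bigID (mem (rich_vertices L W l))) /=.
apply: leq_trans (leq_addr _ _); apply: leq_sum => x xr.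
have xW : x \in W l by move: xr; rewrite inE => /andP[].
rewrite sum1_card; apply: subset_leq_card; apply/subsetP => v vc.
have sub : forall i, shrink L W l x i \subset W i by move=> i; exact: shrink_sub.
rewrite unfold_in /= (subsetP (copies_sub E S C GR sub) _ vc) /=.
by move: vc; rewrite inE => /andP[/in_box/(_ l)]; rewrite /shrink eqxx inE.
Qed.

Lemma embedding : rho * \prod_i (eta * #|A i|%:R) <= #|copies E S C GR A|%:R.
Proof.
have eT : ~: S :|: S = setT by rewrite setUC setUCr.
have -> : \prod_i (eta * #|A i|%:R) = \prod_(i in ~: S :|: S) (eta * #|A i|%:R).
  by apply: eq_bigl => i; rewrite eT inE.
apply: (@embedding_from #|~: S| (~: S) A 0%N) => //.
- exact: max_card.
- by move=> i _; rewrite expr0 mul1r.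
- by move=> i j x y _; rewrite eT inE.
Qed.

End Embedding.

(** * Partitioning the product of the parts into boxes *)

Section BoxPartition.
Variables (R : realType) (V T : finType).
Implicit Types (A : V -> {set T}) (U : {set T}) (v x : {ffun V -> T}).
Implicit Types (Lam : V * V -> {set {ffun V -> T}}).

Definition set_part A i U : V -> {set T} := fun k => if k == i then U else A k.

Definition upd2 (ij : V * V) x (p : T * T) : {ffun V -> T} :=
  [ffun k => if k == ij.1 then p.1 else if k == ij.2 then p.2 else x k].

Definition slice (ij : V * V) (B : {set {ffun V -> T}}) x : {set T * T} :=
  [set p | upd2 ij x p \in B].

Variables (P : V -> {set T}) (E : {set {set V}}) (eps theta : R) (n : nat).
(* [good] is the property of sparse sets of pairs to be propagated; it only has
   to be additive over disjoint unions. *)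
Variable good : V * V -> {set T * T} -> Prop.
Hypotheses (cardP : forall i, #|P i| = n) (simpE : simple_graph E).
Hypotheses (eps0 : 0 <= eps) (eps1 : eps <= 1) (theta0 : 0 <= theta).
Hypothesis good0 : forall ij, good ij set0.
Hypothesis goodU : forall ij (B B' : {set T * T}), [disjoint B & B'] ->
  good ij B -> good ij B' -> good ij (B :|: B').
Hypothesis split : forall A, (forall i, A i \subset P i) ->
  (forall i, theta * n%:R <= #|A i|%:R) ->
  exists i j U U', [/\ [set i; j] \in E, U \subset A i /\ U' \subset A j,
    eps * #|A i|%:R <= #|U|%:R, eps * #|A j|%:R <= #|U'|%:R &
    good (i, j) (setX U U')].

Lemma slice_disjoint ij (B B' : {set {ffun V -> T}}) x :
  [disjoint B & B'] -> [disjoint slice ij B x & slice ij B' x].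
Proof.
move=> dB; rewrite disjoints_subset; apply/subsetP => p; rewrite !inE => pB.
by rewrite (disjointFr dB pB).
Qed.

Lemma sliceU ij (B B' : {set {ffun V -> T}}) x :
  slice ij (B :|: B') x = slice ij B x :|: slice ij B' x.
Proof. by apply/setP => p; rewrite !inE. Qed.

(* V-dimensional boxes, not pairs of parts, are split: a box containing a sparse
   pair U x U' gives one box labelled (i, j) and two smaller boxes to recurse on.
   No regularity lemma is needed, and in the end the slices labelled by a single
   pair fill a fraction of P i x P j that depends on |V| only. *)
Lemma box_partition d A : (forall i, A i \subset P i) ->
  exists Lam, [/\ forall ij, Lam ij \subset box A,
    forall ij, Lam ij != set0 -> [set ij.1; ij.2] \in E,
    forall ij x, good ij (slice ij (Lam ij) x) &
    #|box A :\: \bigcup_ij Lam ij|%:R <=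
      (1 - eps ^+ 2) ^+ d * #|box A|%:R + 2 ^+ d * (theta * n%:R ^+ #|V|)].
Proof.
have slice0 ij x : slice ij set0 x = set0 by apply/setP => p; rewrite !inE.
have eps2 : 0 <= 1 - eps ^+ 2 by rewrite subr_ge0 exprn_ile1.
have th0 : 0 <= theta * n%:R ^+ #|V| by rewrite mulr_ge0 // exprn_ge0.
have triv A' (c : R) : (#|box A'|%:R <= c) -> exists Lam,
    [/\ forall ij, Lam ij \subset box A',
    forall ij, Lam ij != set0 -> [set ij.1; ij.2] \in E,
    forall ij x, good ij (slice ij (Lam ij) x) &
    #|box A' :\: \bigcup_ij Lam ij|%:R <= c].
  move=> h; exists (fun _ => set0); split => //.
  - by move=> ij; rewrite sub0set.
  - by move=> ij; rewrite eqxx.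
  - by move=> ij x; rewrite slice0.
  - by rewrite big1 // setD0.
elim: d A => [|d IHd] A AP.
  by apply: triv; rewrite !expr0 !mul1r lerDl.
(* A box with a side shorter than theta n is given up. At most 2^d boxes are lost so, since every
   split leaves two boxes to recurse on. *)
have [small|/forallNP big] := pselect (exists i, #|A i|%:R < theta * n%:R).
  apply: triv; case: small => i small.
  apply: (@le_trans _ _ (theta * n%:R ^+ #|V|)).
    have h : (\prod_(k | k != i) #|A k| <= n ^ #|V|.-1)%N.
      rewrite -(cardC1 i) -prod_nat_const; apply: leq_prod => k _.
      by rewrite -(cardP k) subset_leq_card.
    have V0 : (0 < #|V|)%N by apply/card_gt0P; exists i.
    rewrite card_box (bigD1 i) //= natrM -(prednK V0) exprS mulrA.
    by apply: ler_pM => //; [exact: ltW | rewrite -natrX ler_nat].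
  rewrite -[leLHS]add0r lerD ?mulr_ge0 ?exprn_ge0 //.
  by rewrite -[leLHS]mul1r ler_wpM2r // exprn_ege1 // ler1n.
have {}big i : theta * n%:R <= #|A i|%:R.
  by rewrite leNgt; apply/negP; exact: big.
have [i [j [U [U' [ij [UA U'A] Us U's gd]]]]] := split AP big.
have jni : j != i.
  by apply/eqP => e; have := simpE ij; rewrite e setUid cards1.
(* A3 lies over U x U' and gets the label (i, j); A1 avoids U, and A2 lies over U but avoids U'. A3
   takes at least eps^2 of the volume, whence the factor 1 - eps^2. *)
pose A1 := set_part A i (A i :\: U).
pose A2 := set_part (set_part A i U) j (A j :\: U').
pose A3 := set_part (set_part A i U) j U'.
have A1P k : A1 k \subset P k.
  by rewrite /A1 /set_part; case: eqP => [->|_] //; apply: subset_trans (AP i); exact: subsetDl.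
have A2P k : A2 k \subset P k.
  rewrite /A2 /set_part; case: eqP => [->|_]; first by apply: subset_trans (AP j); exact: subsetDl.
  by case: eqP => [->|_] //; apply: subset_trans (AP i).
have in1 v : (v \in box A1) = (v \in box A) && (v i \notin U).
  apply/in_box/andP => [h|[/in_box h vU] k].
    have := h i; rewrite /A1 /set_part eqxx inE => /andP[-> vA]; split => //.
    apply/in_box => k; have := h k; rewrite /A1 /set_part.
    by case: eqP => [->|//]; rewrite vA.
  by rewrite /A1 /set_part; case: eqP => [->|//]; rewrite inE vU h.
have in2 v : (v \in box A2) = (v \in box A) && ((v i \in U) && (v j \notin U')).
  apply/in_box/andP => [h|[/in_box h /andP[vU vU']] k].
    have := h j; rewrite /A2 /set_part eqxx inE => /andP[-> vA].
    have := h i; rewrite /A2 /set_part eq_sym (negPf jni) eqxx => vU.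
    rewrite vU; split => //; apply/in_box => k; have := h k.
    rewrite /A2 /set_part; case: eqP => [->|_]; first by rewrite vA.
    by case: eqP => [->|//]; rewrite (subsetP UA).
  rewrite /A2 /set_part; case: eqP => [->|_]; first by rewrite inE vU' h.
  by case: eqP => [->|_].
have in3 v : (v \in box A3) = (v \in box A) && ((v i \in U) && (v j \in U')).
  apply/in_box/andP => [h|[/in_box h /andP[vU vU']] k].
    have := h j; rewrite /A3 /set_part eqxx => vU'.
    have := h i; rewrite /A3 /set_part eq_sym (negPf jni) eqxx => vU.
    rewrite vU vU'; split => //; apply/in_box => k; have := h k.
    rewrite /A3 /set_part; case: eqP => [->|_]; first by rewrite (subsetP U'A).
    by case: eqP => [->|//]; rewrite (subsetP UA).
  rewrite /A3 /set_part; case: eqP => [->|_] //.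
  by case: eqP => [->|_].
have [L1 [L1A L1E L1g L1c]] := IHd A1 A1P.
have [L2 [L2A L2E L2g L2c]] := IHd A2 A2P.
pose L3 (kl : V * V) := if kl == (i, j) then box A3 else set0.
have L3A kl : L3 kl \subset box A3 by rewrite /L3; case: ifP; rewrite ?sub0set.
have d12 kl : [disjoint L1 kl & L2 kl].
  apply: (disjointW (L1A kl) (L2A kl)); rewrite disjoints_subset.
  by apply/subsetP => v; rewrite in_setC in1 in2 => /andP[-> /negPf vU]; rewrite vU.
have d123 kl : [disjoint L1 kl :|: L2 kl & L3 kl].
  apply: (disjointWr (L3A kl)); rewrite disjoints_subset.
  apply/subsetP => v; rewrite in_setU in_setC in3.
  case/orP => [/(subsetP (L1A kl))|/(subsetP (L2A kl))]; rewrite ?in1 ?in2.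
    by case/andP => -> /negPf vU; rewrite vU.
  by case/andP => -> /andP[-> /negPf vU']; rewrite vU'.
exists (fun kl => L1 kl :|: L2 kl :|: L3 kl); split.
- move=> kl; rewrite !subUset; apply/andP; split; first (apply/andP; split).
  + by apply: subset_trans (L1A kl) _; apply/subsetP => v; rewrite in1 => /andP[].
  + by apply: subset_trans (L2A kl) _; apply/subsetP => v; rewrite in2 => /andP[].
  + by apply: subset_trans (L3A kl) _; apply/subsetP => v; rewrite in3 => /andP[].
- move=> kl; rewrite !setU_eq0 !negb_and => /orP[/orP[/L1E|/L2E]|] //.
  by rewrite /L3; case: (eqVneq kl (i, j)) => [->|]; rewrite ?eqxx.
- move=> kl x; rewrite !sliceU; apply: goodU.
  + by rewrite -sliceU; exact: slice_disjoint.
  + by apply: goodU => //; exact: slice_disjoint.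
  rewrite /L3; case: eqP => [->|_]; last by rewrite slice0.
  (* A slice of a box is all of U x U' or empty, according to the coordinates of x other than i and
     j. *)
  pose rest := [forall k, (k == i) || (k == j) || (x k \in A k)].
  suff -> : slice (i, j) (box A3) x = if rest then setX U U' else set0.
    by case: rest.
  apply/setP => -[y z]; rewrite in_set in3.
  rewrite !ffunE /= eqxx (negPf jni) eqxx.
  case: (boolP rest) => [/forallP h|]; rewrite !inE /=.
    case: (boolP (y \in U)) => yU; rewrite ?andbF //=.
    case: (boolP (z \in U')) => zU; rewrite ?andbF //= andbT.
    apply/forallP => k; rewrite ffunE /=; case: eqP => [->|/eqP ki].
      exact: (subsetP UA).
    case: eqP => [->|/eqP kj]; first exact: (subsetP U'A).
    by have := h k; rewrite (negPf ki) (negPf kj).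
  rewrite negb_forall => /existsP[k]; rewrite !negb_or => /andP[/andP[ki kj] xk].
  apply/negP => /andP[/forallP/(_ k)].
  by rewrite ffunE /= (negPf ki) (negPf kj) (negPf xk).
- have volA : (#|box A1| + #|box A2| + #|box A3| = #|box A|)%N.
    pose X := [set v : {ffun V -> T} | v i \in U].
    pose X' := [set v : {ffun V -> T} | v j \in U'].
    rewrite -(cardsID X (box A)) -(cardsID X' (box A :&: X)) -addnA addnC.
    rewrite [(#|box A2| + _)%N]addnC; congr (_ + _ + _)%N; apply: eq_card => v.
    + by rewrite in3 !inE andbA.
    + by rewrite in2 !inE; case: (v i \in U); case: (v j \in U'); rewrite ?andbF.
    + by rewrite in1 !inE andbC.
  have vol3 : eps ^+ 2 * #|box A|%:R <= #|box A3|%:R.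
    rewrite !card_box !(bigD1 i (P := predT)) //= !(bigD1 j (P := fun k => k != i)) //=.
    rewrite {1 2}/A3 /set_part !eqxx (eq_sym i j) (negPf jni).
    rewrite (eq_bigr (fun k => #|A k|) (F1 := fun k => #|A3 k|)); last first.
      by move=> k /andP[ki kj]; rewrite /A3 /set_part (negPf ki) (negPf kj).
    rewrite !natrM !mulrA; apply: ler_wpM2r => //.
    have -> : eps ^+ 2 * #|A i|%:R * #|A j|%:R =
              (eps * #|A i|%:R) * (eps * #|A j|%:R) by ring.
    by rewrite ler_pM // mulr_ge0.
  have unc : (#|box A :\: \bigcup_kl (L1 kl :|: L2 kl :|: L3 kl)| <=
      #|box A1 :\: \bigcup_kl L1 kl| + #|box A2 :\: \bigcup_kl L2 kl|)%N.
    apply: leq_trans (leq_card_setU _ _); apply: subset_leq_card.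
    apply/subsetP => v; rewrite !inE => /andP[vL vA].
    have vL1 kl : v \in L1 kl :|: L2 kl :|: L3 kl -> False.
      by move=> h; case/bigcupP: vL; exists kl.
    have n1 : v \notin \bigcup_kl L1 kl.
      by apply/bigcupP => -[kl _ h]; apply: (vL1 kl); rewrite !inE h.
    have n2 : v \notin \bigcup_kl L2 kl.
      by apply/bigcupP => -[kl _ h]; apply: (vL1 kl); rewrite !inE h orbT.
    have n3 : v \notin box A3.
      by apply/negP => h; apply: (vL1 (i, j)); rewrite !inE /L3 eqxx h orbT.
    rewrite n1 n2 /=.
    have vA' : v \in box A by rewrite inE.
    move: n3.
    have := in1 v; have := in2 v; have := in3 v; rewrite vA' /=.
    rewrite !inE => -> -> ->.
    by case: (v i \in U); case: (v j \in U').
  move: unc; rewrite -(ler_nat R) natrD => /le_trans; apply.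
  have h : #|box A1|%:R + #|box A2|%:R <= (1 - eps ^+ 2) * #|box A|%:R.
    by move: vol3; rewrite -volA !natrD; lra.
  have q0 : 0 <= (1 - eps ^+ 2) ^+ d by exact: exprn_ge0.
  have := ler_wpM2l q0 h; move: L1c L2c.
  rewrite (exprS (1 - eps ^+ 2) d) (exprS 2 d) mulrDr.
  by move: ((1 - eps ^+ 2) ^+ d) => q; move: (2 ^+ d) => p; nra.
Qed.


(* Average over the coordinates other than i and j; n ^ 2 appears because x is
   drawn from the whole box, its coordinates i and j being overwritten. *)
Lemma dense_slice i j (B : {set {ffun V -> T}}) : i != j -> (0 < n)%N ->
  B \subset box P ->
  exists2 x, slice (i, j) B x \subset setX (P i) (P j) &
    (#|B| * n ^ 2 <= #|slice (i, j) B x| * n ^ #|V|)%N.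
Proof.
move=> ij n0 BP.
have cardBP : #|box P| = (n ^ #|V|)%N.
  by rewrite card_box (eq_bigr (fun _ => n)) // prod_nat_const.
suff [x h] : exists x, (#|B| * n ^ 2 <= #|slice (i, j) B x| * n ^ #|V|)%N.
  exists x => //; apply/subsetP => -[y z]; rewrite in_set => /(subsetP BP)/in_box h'.
  have := h' i; have := h' j.
  by rewrite !ffunE /= !eqxx eq_sym (negPf ij) in_setX => -> ->.
pose G := [set q : {ffun V -> T} * (T * T) | (q.1 \in box P) && (q.2 \in slice (i, j) B q.1)].
have leG : (#|B| * n ^ 2 <= #|G|)%N.
  have -> : (#|B| * n ^ 2 = #|setX B (setX (P i) (P j))|)%N.
    by rewrite !cardsX !cardP expnS expn1.
  (* Exchanging the coordinates i and j of v with the given pair is an involution; it embeds B x P i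
     x P j into G. *)
  pose h (q : {ffun V -> T} * (T * T)) := (upd2 (i, j) q.1 q.2, (q.1 i, q.1 j)).
  have hK q : h (h q) = q.
    case: q => v [y z]; rewrite /h /=; congr (_, (_, _)).
    - apply/ffunP => k; rewrite !ffunE /=; case: eqP => [->//|_].
      by case: eqP => [->|].
    - by rewrite ffunE eqxx.
    - by rewrite ffunE /= eq_sym (negPf ij) eqxx.
  rewrite -[leqLHS](card_imset _ (can_inj hK)); apply: subset_leq_card.
  apply/subsetP => _ /imsetP[[v [y z]] + ->].
  rewrite !in_setX /= => /andP[vB /andP[yP zP]]; rewrite in_set /=.
  have /in_box vP := subsetP BP _ vB.
  apply/andP; split.
    apply/in_box => k; rewrite ffunE /=; case: eqP => [->//|_].
    by case: eqP => [->|].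
  by rewrite in_set; have := hK (v, (y, z)); rewrite /h /= => -[-> _ _].
have eG : (#|G| = \sum_(x in box P) #|slice (i, j) B x|)%N.
  rewrite -sum1_card.
  rewrite (eq_bigr (fun x => \sum_(p | p \in slice (i, j) B x) 1)%N); last first.
    by move=> x _; rewrite sum1_card.
  by rewrite pair_big_dep /=; apply: eq_bigl => q; rewrite in_set.
apply: contrapT => /forallNP poor.
have : (\sum_(x in box P) (#|slice (i, j) B x| * n ^ #|V|).+1 <=
        \sum_(x in box P) (#|B| * n ^ 2))%N.
  by apply: leq_sum => x _; rewrite ltnNge; apply/negP; exact: poor.
rewrite sum_nat_const cardBP.
rewrite (eq_bigr (fun x => #|slice (i, j) B x| * n ^ #|V| + 1)%N); last first.
  by move=> x _; rewrite addn1.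
rewrite big_split /= sum1_card cardBP -big_distrl /= -eG => h.
have nV : (0 < n ^ #|V|)%N by rewrite expn_gt0 n0.
have := leq_trans h (leq_mul (leqnn (n ^ #|V|)%N) leG).
by rewrite [leqRHS]mulnC -[leqRHS]addn0 leq_add2l leqNgt nV.
Qed.

(** At most 1/4 + 1/4 of the full box stays uncovered, so one of the |V|^2 labels receives a share
    of at least 1 / (4|V|^2), and averaging finds a slice with the same share. *)
Lemma large_good_slice d : (0 < #|V|)%N -> (0 < n)%N ->
  (1 - eps ^+ 2) ^+ d <= 4^-1 -> 2 ^+ d * theta <= 4^-1 ->
  exists i j (L : {set T * T}), [/\ [set i; j] \in E, L \subset setX (P i) (P j),
    good (i, j) L & n%:R ^+ 2 / (4 * #|V|%:R ^+ 2) <= #|L|%:R :> R].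
Proof.
move=> V0 n0 hd hth.
have [Lam [LamP LamE Lamg unc]] := @box_partition d P (fun i => subxx _).
have cardBP : #|box P|%:R = n%:R ^+ #|V| :> R.
  by rewrite card_box (eq_bigr (fun _ => n)) // prod_nat_const natrX.
have nV : 0 < n%:R ^+ #|V| :> R by rewrite exprn_gt0 // ltr0n.
have VR : 0 < #|V|%:R :> R by rewrite ltr0n.
have cov : n%:R ^+ #|V| / 2 <= \sum_ij #|Lam ij|%:R :> R.
  have h1 : #|box P|%:R <= \sum_ij #|Lam ij|%:R + #|box P :\: \bigcup_ij Lam ij|%:R :> R.
    rewrite -natr_sum -natrD ler_nat -(cardsID (\bigcup_ij Lam ij) (box P)).
    rewrite leq_add2r; apply: leq_card_cover => v; rewrite inE => /andP[_].
    by case/bigcupP => ij _; exists ij.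
  rewrite cardBP in h1 unc; move: h1 unc.
  have := ler_wpM2r (ltW nV) hd; have := ler_wpM2r (ltW nV) hth.
  rewrite -mulrA; lra.
have [[i j] hij] : exists ij, n%:R ^+ #|V| / (4 * #|V|%:R ^+ 2) <= #|Lam ij|%:R :> R.
  apply: contrapT => /forallNP poor.
  have : \sum_ij #|Lam ij|%:R <= \sum_(ij : V * V) (n%:R ^+ #|V| / (4 * #|V|%:R ^+ 2)) :> R.
    by apply: ler_sum => ij _; have /negP := poor ij; rewrite -ltNge => /ltW.
  rewrite sumr_const card_prod -[X in _ <= X]mulr_natl natrM.
  have -> : #|V|%:R * #|V|%:R * (n%:R ^+ #|V| / (4 * #|V|%:R ^+ 2)) =
     n%:R ^+ #|V| / 4 :> R by field; rewrite gt_eqF.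
  by move: cov nV; lra.
have Lij : [set i; j] \in E.
  apply: (LamE (i, j)); rewrite -card_gt0 -(ltr0n R); apply: lt_le_trans hij; pos.
have ij : i != j by apply/eqP => e; have := simpE Lij; rewrite e setUid cards1.
have [x sub big] := dense_slice ij n0 (LamP (i, j)).
exists i, j, (slice (i, j) (Lam (i, j)) x); split => //.
move: big; rewrite -(ler_nat R) !natrM !natrX => big.
rewrite -(ler_pM2r nV); apply: le_trans big.
have -> : n%:R ^+ 2 / (4 * #|V|%:R ^+ 2) * n%:R ^+ #|V| =
   n%:R ^+ #|V| / (4 * #|V|%:R ^+ 2) * n%:R ^+ 2 :> R by ring.
by apply: ler_wpM2r => //; rewrite exprn_ge0.
Qed.

End BoxPartition.

(** * Sparse pairs in containers *)

Section SparsePair.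
Variables (R : realType) (V T : finType).
Implicit Types (U : {set T}) (C G : {set {set T}}) (L : {set T * T}).

Definition lpairs C L : {set T * T} := [set p in L | [set p.1; p.2] \in C].

Lemma pair_set_inj U U' : [disjoint U & U'] ->
  {in setX U U' &, injective (fun p : T * T => [set p.1; p.2])}.
Proof.
move=> dU [a b] [c d]; rewrite !in_setX /= => /andP[aU bU'] /andP[cU dU'] e.
have : a \in [set c; d] by rewrite -e set21.
have : b \in [set c; d] by rewrite -e set22.
rewrite !inE => /orP[/eqP eb|/eqP ->].
  by rewrite eb (disjointFr dU cU) in bU'.
case/orP => /eqP ea; first by rewrite ea.
by rewrite ea (disjointFl dU dU') in aU.
Qed.

Lemma card_pair_image C U U' L : [disjoint U & U'] -> L \subset setX U U' ->
  #|C :&: [set [set p.1; p.2] | p in L]| = #|lpairs C L|.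
Proof.
move=> dU LU; rewrite -(card_in_imset (f := fun p : T * T => [set p.1; p.2])
  (D := mem (lpairs C L))); last first.
  move=> p q; rewrite !inE => /andP[pL _] /andP[qL _].
  by apply: (pair_set_inj dU); apply: (subsetP LU).
apply: eq_card => e; rewrite inE; apply/andP/imsetP => [[eC /imsetP[p pL ee]]|[p + ->]].
  by exists p; rewrite // inE pL -ee.
by rewrite inE => /andP[pL pC]; split=> //; apply: imset_f.
Qed.

Lemma card_edges_between G U U' : [disjoint U & U'] ->
  #|edges_between G U U'| = #|pairs_in G U U'|.
Proof.
move=> dU; have -> : pairs_in G U U' = lpairs G (setX U U') by [].
rewrite -(card_pair_image G dU (subxx _)); apply: eq_card => e.
rewrite !inE; case: (e \in G) => //=; apply/exists_inP/imsetP.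
  case=> u uU /exists_inP[w wU' /eqP ee].
  by exists (u, w); rewrite // in_setX uU.
case=> -[u w]; rewrite in_setX => /andP[uU wU'] ->.
by exists u => //; apply/exists_inP; exists w.
Qed.

Definition regular_pairs (P : V -> {set T}) (E : {set {set V}}) (m : nat)
    (mu : R) G :=
  forall i j, [set i; j] \in E ->
    eps_regular mu G (P i) (P j) /\ #|edges_between G (P i) (P j)| = m.

Lemma regular_pairs_box (P : V -> {set T}) E n m mu G i j U U' :
  disjoint_parts P n -> (0 < n)%N -> regular_pairs P E m mu G ->
  [set i; j] \in E -> i != j -> eps_subset mu U (P i) -> eps_subset mu U' (P j) ->
  (1 - mu) * (m%:R / n%:R ^+ 2) * (#|U|%:R * #|U'|%:R) <= #|pairs_in G U U'|%:R.
Proof.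
move=> [cardP disjP] n0 reg ijE ij sU sU'.
have n0R : 0 < n%:R :> R by rewrite ltr0n.
have [regij mij] := reg i j ijE.
have := regij _ _ sU sU'; rewrite /density mij !cardP ler_distl => /andP[+ _].
have dU : [disjoint U & U'].
  by apply: disjointW (disjP i j ij); [case: sU | case: sU'].
rewrite card_edges_between //.
have [e0|] := eqVneq (#|U| * #|U'|)%N 0%N.
  by move=> _; rewrite -natrM e0 mulr0.
rewrite -lt0n -(ltr0n R) natrM => UU'.
rewrite ler_pdivlMr //; apply: le_trans; rewrite ler_pM2r //.
by rewrite mulrBl mul1r expr2.
Qed.

End SparsePair.

(** A Bernoulli-type bound [(1 - x) ^+ d * (1 + d%:R * x) <= 1], used with d x >= 3. *)
Lemma exists_small_power (R : realType) (x : R) : 0 < x -> x < 1 ->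
  exists d, (1 - x) ^+ d <= 4^-1.
Proof.
move=> x0 x1; have y0 : 0 <= 1 - x by rewrite subr_ge0 ltW.
have bern d : (1 - x) ^+ d * (1 + d%:R * x) <= 1.
  elim: d => [|d IH]; first by rewrite expr0 mul0r addr0 mulr1.
  apply: le_trans IH; rewrite exprS -mulrA mulrCA; apply: ler_wpM2l.
    exact: exprn_ge0.
  rewrite -natr1; have : 0 <= d%:R * x ^+ 2 by rewrite mulr_ge0 ?sqr_ge0.
  by rewrite expr2; nra.
exists (Num.truncn (3 / x)).+1; set d := _.+1.
have dx : 3 <= d%:R * x.
  by rewrite -ler_pdivrMr // ltW // Num.Theory.truncnS_gt.
have := bern d; have := exprn_ge0 d y0; set q := _ ^+ d => q0 h.
rewrite -[leRHS]mul1r ler_pdivlMr //; apply: le_trans h.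
by apply: ler_wpM2l => //; lra.
Qed.

(* The covered fraction 1 / (4 |V|^2) must not depend on delta: the final count
   gains delta to the power of (covered fraction) * m, whereas mu is tiny compared
   with delta. *)
Lemma sparse_pair (R : realType) (V : finType) (delta : R) :
  0 < delta -> delta <= 1 -> (0 < #|V|)%N ->
  exists2 mu : R, 0 < mu <= 2^-1 & exists2 gam : R, 0 < gam &
  forall (T : finType) (P : V -> {set T}) (n : nat) (E : {set {set V}})
    (S : {set V}) (C GR : {set {set T}}) (rho : R),
  disjoint_parts P n -> (0 < n)%N -> simple_graph E ->
  (forall f, f \in E -> ~~ (f \subset S)) -> partite_hypergraph P S GR ->
  0 <= rho ->
  (forall W, (forall i, i \in S -> eps_subset mu (W i) (P i)) ->
     rho * \prod_(i in S) #|W i|%:R <=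
       #|[set e in GR | e \subset \bigcup_(i in S) W i]|%:R) ->
  #|copies E S C GR P|%:R < rho * (gam * n%:R ^+ #|V|) ->
  exists i j (L : {set T * T}), [/\ [set i; j] \in E, L \subset setX (P i) (P j),
    n%:R ^+ 2 / (4 * #|V|%:R ^+ 2) <= #|L|%:R :> R,
    #|lpairs C L|%:R <= delta * #|L|%:R &
    forall m G, regular_pairs P E m mu G ->
      (1 - mu) * (m%:R / n%:R ^+ 2) * #|L|%:R <= #|lpairs G L|%:R].
Proof.
move=> d0 d1 V0.
have VR : 1 <= #|V|%:R :> R by rewrite ler1n.
pose dv := delta ^+ #|V|.
have dv0 : 0 < dv by exact: exprn_gt0.
have dv1 : dv <= 1 by rewrite exprn_ile1 // ltW.
pose eps := dv / (2 * #|V|%:R).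
have eps0 : 0 < eps by rewrite divr_gt0 // mulr_gt0 // ltr0n.
have eps1 : eps <= 2^-1.
  rewrite /eps ler_pdivrMr; last by rewrite mulr_gt0 // ltr0n.
  by apply: (le_trans dv1); lra.
pose eta := dv / 2.
have eta0 : 0 < eta by exact: divr_gt0.
have e20 : 0 < eps ^+ 2 by exact: exprn_gt0.
have e21 : eps ^+ 2 < 1.
  by rewrite expr_lt1 ?ltW // (le_lt_trans eps1) // invf_lt1 // ltr1n.
have [d hd] := exists_small_power e20 e21.
pose theta : R := (4 * 2 ^+ d)^-1.
have theta0 : 0 < theta by rewrite invr_gt0 mulr_gt0 ?exprn_gt0.
have hth : 2 ^+ d * theta <= 4^-1.
  by rewrite /theta invfM mulrCA mulfV ?mulr1 // lt0r_neq0 // exprn_gt0.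
have theta1 : theta <= 1.
  rewrite /theta invf_le1 ?mulr_gt0 ?exprn_gt0 //.
  have : 1 <= 2 ^+ d :> R by rewrite exprn_ege1 // ler1n.
  lra.
(* In boxes with sides at least theta n, [dv * theta] lets lower regularity apply to the root
   candidates, and [eps * theta] lets regularity of G apply to the sparse pairs. *)
pose mu := Num.min (dv * theta) (eps * theta).
have mu0 : 0 < mu by rewrite /mu lt_min; apply/andP; split; exact: mulr_gt0.
have mu1 : mu <= dv * theta by rewrite /mu ge_min lexx.
have mu2 : mu <= eps * theta by rewrite /mu ge_min lexx orbT.
exists mu.
  rewrite mu0; apply: (le_trans mu2); rewrite -[leRHS]mulr1.
  by apply: ler_pM => //; apply: ltW.
exists ((eta * theta) ^+ #|V|); first by apply: exprn_gt0; exact: mulr_gt0.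
move=> T P n E S C GR rho dP n0 simpE ES part rho0 low few.
have [cardP disjP] := dP.
have n0R : 0 < n%:R :> R by rewrite ltr0n.
(* A slice is not a product set, so regularity cannot be applied to it directly. Both bounds hold on
   each rectangle and add up. *)
pose good (ij : V * V) (L : {set T * T}) :=
  #|lpairs C L|%:R <= delta * #|L|%:R /\
  forall m G, regular_pairs P E m mu G ->
      (1 - mu) * (m%:R / n%:R ^+ 2) * #|L|%:R <= #|lpairs G L|%:R.
have lpairs0 G : lpairs G set0 = set0 :> {set T * T}.
  by apply/setP => p; rewrite !inE.
have cardlU G (B B' : {set T * T}) : [disjoint B & B'] ->
    #|lpairs G (B :|: B')|%:R = #|lpairs G B|%:R + #|lpairs G B'|%:R :> R.
  move=> dB; rewrite -natrD; congr _%:R.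
  have -> : lpairs G (B :|: B') = lpairs G B :|: lpairs G B'.
    by apply/setP => p; rewrite !inE andb_orl.
  apply/eqP; rewrite (leq_card_setU _ _); apply: disjointW dB.
    by apply/subsetP => p; rewrite inE => /andP[].
  by apply/subsetP => p; rewrite inE => /andP[].
have cardU (B B' : {set T * T}) : [disjoint B & B'] ->
    #|B :|: B'|%:R = #|B|%:R + #|B'|%:R :> R.
  by move=> dB; rewrite -natrD; congr _%:R; apply/eqP; rewrite (leq_card_setU _ _).
have thn (A : V -> {set T}) : (forall i, theta * n%:R <= #|A i|%:R) ->
    forall i, 0 < #|A i|%:R :> R.
  by move=> h i; apply: lt_le_trans (h i); exact: mulr_gt0.
have sides (A : V -> {set T}) : (forall i : V, A i \subset P i) ->
    (forall i, theta * n%:R <= #|A i|%:R) ->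
  exists i j (U U' : {set T}), [/\ [set i; j] \in E, U \subset A i /\ U' \subset A j,
    eps * #|A i|%:R <= #|U|%:R, eps * #|A j|%:R <= #|U'|%:R &
    good (i, j) (setX U U')].
  move=> AP Ath.
  have [i [j [U [U' [ij UA U'A [Us U's] sparse]]]]] : exists i j (U U' : {set T}),
      [/\ [set i; j] \in E, U \subset A i, U' \subset A j,
       eps * #|A i|%:R <= #|U|%:R /\ eps * #|A j|%:R <= #|U'|%:R &
       #|pairs_in C U U'|%:R <= delta * (#|U|%:R * #|U'|%:R)].
    apply: contrapT => no; move: few; rewrite ltNge => /negP; apply.
    have dense i j (U U' : {set T}) : [set i; j] \in E -> U \subset A i -> U' \subset A j ->
        eps * #|A i|%:R <= #|U|%:R -> eps * #|A j|%:R <= #|U'|%:R ->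
        delta * (#|U|%:R * #|U'|%:R) < #|pairs_in C U U'|%:R.
      move=> ij UA U'A Us U's; rewrite ltNge; apply/negP => h; apply: no.
      by exists i, j, U, U'.
    have An0 i : A i != set0 by rewrite -card_gt0 -(ltr0n R) (thn A Ath).
    have As i : mu * n%:R <= dv * #|A i|%:R.
      apply: (@le_trans _ _ (dv * (theta * n%:R))); last by rewrite ler_pM2l.
      by rewrite mulrA ler_pM2r.
    have lowA (W : V -> {set T}) :
        (forall i, i \in S -> W i \subset P i /\ mu * n%:R <= #|W i|%:R) ->
        rho * \prod_(i in S) #|W i|%:R <=
        #|[set e in GR | e \subset \bigcup_(i in S) W i]|%:R.
      by move=> hW; apply: low => i /hW[WP Ws]; split; rewrite ?cardP.
    have := embedding disjP simpE ES d0 d1 rho0 AP An0 part As lowA dense.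
    have sub : #|copies E S C GR A|%:R <= #|copies E S C GR P|%:R :> R.
      by rewrite ler_nat subset_leq_card //; exact: copies_sub.
    move=> h; apply: le_trans sub; apply: le_trans h; apply: ler_wpM2l => //.
    rewrite -exprMn -prodr_const; apply: ler_prod => i _; apply/andP; split.
      by apply: mulr_ge0 => //; apply: mulr_ge0; apply: ltW.
    by rewrite -[leLHS]mulrA ler_pM2l.
  exists i, j, U, U'; split => //; split.
    by rewrite cardsX natrM.
  move=> m G reg; rewrite cardsX natrM.
  apply: (regular_pairs_box dP n0 reg ij).
  - by apply/eqP => e; have := simpE _ ij; rewrite e setUid cards1.
  - split; first by apply: subset_trans (AP i).
    apply: le_trans Us; rewrite cardP.
    apply: (@le_trans _ _ (eps * (theta * n%:R))); last by rewrite ler_pM2l.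
    by rewrite mulrA ler_pM2r.
  - split; first by apply: subset_trans (AP j).
    apply: le_trans U's; rewrite cardP.
    apply: (@le_trans _ _ (eps * (theta * n%:R))); last by rewrite ler_pM2l.
    by rewrite mulrA ler_pM2r.
have eps01 : eps <= 1 by lra.
have goodU ij (B B' : {set T * T}) : [disjoint B & B'] ->
    good ij B -> good ij B' -> good ij (B :|: B').
  move=> dB [h1 h2] [h3 h4]; split.
    by rewrite cardlU // cardU // mulrDr lerD.
  by move=> m G reg; rewrite cardlU // cardU // mulrDr lerD ?h2 ?h4.
have goods0 ij : good ij set0.
  by split=> [|m G _]; rewrite lpairs0 cards0 mulr0.
have [i [j [L [h1 h2 [h3 h4] h5]]]] := large_good_slice cardP simpE (ltW eps0)
  eps01 (ltW theta0) goods0 goodU sides V0 n0 hd hth.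
by exists i, j, L; split.
Qed.

(** * Counting graphs by fingerprints *)

(** Forcing one more element multiplies the count by (m - i) / (N - i) <= m / N; stated without
    division. *)
Lemma bin_ratio N m w : (w <= m)%N -> (m <= N)%N ->
  ('C(N - w, m - w) * N ^ w <= 'C(N, m) * m ^ w)%N.
Proof.
move=> wm mN; elim: w wm => [|w IH] wm; first by rewrite !subn0 !expn0.
have {}IH := IH (ltnW wm).
have e : ((N - w) * 'C(N - w.+1, m - w.+1) = (m - w) * 'C(N - w, m - w))%N.
  rewrite subnS subnS mul_bin_diag prednK // subn_gt0 //.
have Nw : (0 < N - w)%N by rewrite subn_gt0; apply: leq_trans mN.
rewrite -(leq_pmul2l Nw) mulnA e.
apply: (@leq_trans ((N - w) * m * ('C(N - w, m - w) * N ^ w))%N).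
  rewrite [(N ^ w.+1)%N]expnS.
  have -> : ((m - w) * 'C(N - w, m - w) * (N * N ^ w) =
     (m - w) * N * ('C(N - w, m - w) * N ^ w))%N by ring.
  rewrite leq_mul2r; apply/orP; right.
  by rewrite !mulnBl mulnC leq_sub2l // leq_mul2l mN orbT.
have -> : ((N - w) * ('C(N, m) * m ^ w.+1) = (N - w) * m * ('C(N, m) * m ^ w))%N.
  by rewrite expnS; ring.
by rewrite leq_mul2l IH orbT.
Qed.

Lemma bin_fact_le d k : ('C(d, k) * k`! <= d ^ k)%N.
Proof.
rewrite bin_ffact; elim: k => [|k IH]; first by rewrite ffactn0 expn0.
by rewrite ffactnSr expnSr leq_mul // leq_subr.
Qed.

Section Counting.
Variables (R : realType) (X J : finType).
Implicit Types (W Y G D U : {set X}).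

Lemma card_supersets Y W m N : (#|Y| <= N)%N -> (m <= N)%N -> (0 < N)%N ->
  #|[set G : {set X} | [&& G \subset Y, W \subset G & #|G| == m]]|%:R <=
    'C(N, m)%:R * (m%:R / N%:R) ^+ #|W| :> R.
Proof.
move=> YN mN N0; set Gs := [set G | _].
have rhs0 : 0 <= 'C(N, m)%:R * (m%:R / N%:R) ^+ #|W| :> R.
  by rewrite mulr_ge0 // exprn_ge0 // divr_ge0.
have [e0|/set0Pn[G0]] := eqVneq Gs set0; first by rewrite e0 cards0.
rewrite inE => /and3P[G0Y WG0 /eqP G0m].
have WY : W \subset Y by apply: subset_trans WG0 G0Y.
have Wm : (#|W| <= m)%N by rewrite -G0m subset_leq_card.
have le : (#|Gs| <= 'C(N - #|W|, m - #|W|))%N.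
  have inj : {in Gs &, injective (fun G => G :\: W)}.
    move=> G G'; rewrite !inE => /and3P[_ WG _] /and3P[_ WG' _] e.
    by rewrite -(setID G W) -(setID G' W) (setIidPr WG) (setIidPr WG') e.
  rewrite -(card_in_imset inj).
  apply: (@leq_trans 'C(#|Y :\: W|, m - #|W|)); last first.
    rewrite cardsD (setIidPr WY); apply: leq_bin2l.
    by rewrite leq_sub2r.
  rewrite -cards_draws; apply: subset_leq_card; apply/subsetP => _ /imsetP[G + ->].
  rewrite !inE => /and3P[GY WG /eqP Gm].
  by rewrite setSD //= cardsD (setIidPr WG) Gm.
apply: (@le_trans _ _ ('C(N - #|W|, m - #|W|))%:R); first by rewrite ler_nat.
rewrite expr_div_n mulrA ler_pdivlMr ?exprn_gt0 ?ltr0n //.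
by rewrite -!natrX -!natrM ler_nat bin_ratio.
Qed.

Variables (E : {set J}) (Y : J -> {set X}) (N m : nat).
Hypotheses (YN : forall f, f \in E -> (#|Y f| <= N)%N) (mN : (m <= N)%N) (N0 : (0 < N)%N).

Definition uniform_class : {set {set X}} :=
  [set G : {set X} | (G \subset \bigcup_(f in E) Y f) &&
                     [forall f in E, #|G :&: Y f| == m]].

Let a : R := m%:R / N%:R.
Let a0 : 0 <= a. Proof. exact: divr_ge0. Qed.
Let a1 : a <= 1. Proof. by rewrite ler_pdivrMr ?ltr0n // mul1r ler_nat. Qed.

(** G is determined by its traces on the sets [Y f], which are counted separately. Where these sets
    overlap the exponent of a only grows, and a <= 1. *)
Lemma card_uniform_supersets W : W \subset \bigcup_(f in E) Y f ->
  #|[set G in uniform_class | W \subset G]|%:R <= 'C(N, m)%:R ^+ #|E| * a ^+ #|W|.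
Proof.
move=> WY; set Gs := [set G in _ | _].
pose F f : {set {set X}} := if f \in E then
  [set G : {set X} | [&& G \subset Y f, W :&: Y f \subset G & #|G| == m]]
  else [set set0].
pose h G : {ffun J -> {set X}} := [ffun f => if f \in E then G :&: Y f else set0].
have hinj : {in Gs &, injective h}.
  move=> G G'; rewrite !inE => /andP[/andP[GY _] _] /andP[/andP[G'Y _] _] e.
  rewrite -(setIidPl GY) -(setIidPl G'Y) !big_distrr /=.
  apply: eq_bigr => f fE; have /ffunP/(_ f) := e.
  by rewrite !ffunE fE.
have le : (#|Gs| <= \prod_f #|F f|)%N.
  rewrite -(card_in_imset hinj) -(card_box F).
  apply: subset_leq_card; apply/subsetP => _ /imsetP[G + ->].
  rewrite !inE => /andP[/andP[GY /forall_inP Gm] WG].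
  apply/forallP => f; rewrite ffunE /F; case: ifP => fE; last by rewrite inE.
  by rewrite inE subsetIr setSI //= Gm.
apply: (@le_trans _ _ (\prod_(f in E) ('C(N, m)%:R * a ^+ #|W :&: Y f|))).
  apply: (@le_trans _ _ ((\prod_f #|F f|)%:R)); first by rewrite ler_nat.
  rewrite natr_prod [leRHS]big_mkcond; apply: ler_prod => f _.
  rewrite ler0n /= /F; case: ifP => fE; last by rewrite cards1.
  by apply: card_supersets => //; exact: YN.
rewrite big_split /= prodr_const ler_wpM2l ?exprn_ge0 //.
rewrite prodrXr; apply: ler_wiXn2l => //.
apply: leq_card_cover => w wW; have /bigcupP[f fE wf] := subsetP WY w wW.
by exists f; rewrite // inE wW.
Qed.

(** Union bound over the k-subsets K of D outside of U: there are at most (delta N)^k / k! of them,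
    each costs (m / N)^k, and m^k / k! <= e^m. *)
Lemma card_uniform_dense U D k (delta : R) :
  U \subset \bigcup_(f in E) Y f -> D \subset \bigcup_(f in E) Y f ->
  0 <= delta -> #|D|%:R <= delta * N%:R ->
  #|[set G in uniform_class | (U \subset G) && (k <= #|(G :&: D) :\: U|)%N]|%:R
    <= 'C(N, m)%:R ^+ #|E| * a ^+ #|U| * (delta ^+ k * expR m%:R).
Proof.
move=> UY DY d0 Ds.
pose Ks := [set K : {set X} | (K \subset D :\: U) && (#|K| == k)].
apply: (@le_trans _ _ (\sum_(K in Ks)
    #|[set G in uniform_class | U :|: K \subset G]|%:R)).
  rewrite -natr_sum ler_nat; apply: leq_card_cover => G.
  rewrite inE => /and3P[Gc UG kG].
  have [K] : exists K : {set X}, K \in [set K : {set X} | K \subset (G :&: D) :\: U & #|K| == k].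
    by apply/set0Pn; rewrite -card_gt0 cards_draws bin_gt0.
  rewrite inE => /andP[KG Kk]; exists K.
    rewrite inE Kk andbT; apply: subset_trans KG _.
    by rewrite setSD // subsetIr.
  rewrite inE Gc subUset UG /=; apply: subset_trans KG _.
  by apply/subsetP => x; rewrite !inE => /andP[_ /andP[]].
apply: (@le_trans _ _ (\sum_(K in Ks) ('C(N, m)%:R ^+ #|E| * a ^+ (#|U| + k)))).
  apply: ler_sum => K; rewrite inE => /andP[KDU /eqP Kk].
  have KY : K \subset \bigcup_(f in E) Y f.
    by apply: subset_trans KDU _; apply: subset_trans DY; exact: subsetDl.
  have dUK : [disjoint U & K].
    rewrite disjoint_sym disjoints_subset; apply: subset_trans KDU _.
    by rewrite setDE subsetIr.
  have := @card_uniform_supersets (U :|: K); rewrite subUset UY KY => /(_ isT).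
  suff -> : #|U :|: K| = (#|U| + k)%N by [].
  by apply/eqP; rewrite -Kk (leq_card_setU U K).
rewrite sumr_const -[X in X <= _]mulr_natl exprD.
set c := 'C(N, m)%:R ^+ #|E| * a ^+ #|U|.
have c0 : 0 <= c by rewrite mulr_ge0 // exprn_ge0.
have -> : #|Ks|%:R * ('C(N, m)%:R ^+ #|E| * (a ^+ #|U| * a ^+ k)) =
    c * (#|Ks|%:R * a ^+ k) by rewrite /c; ring.
apply: ler_wpM2l => //.
have KsD : (#|Ks| <= 'C(#|D|, k))%N.
  by rewrite cards_draws leq_bin2l // subset_leq_card // subsetDl.
have kf : 0 < k`!%:R :> R by rewrite ltr0n fact_gt0.
have Nr : 0 < N%:R :> R by rewrite ltr0n.
apply: (@le_trans _ _ (#|D|%:R ^+ k / k`!%:R * a ^+ k)).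
  apply: ler_wpM2r; first exact: exprn_ge0.
  rewrite ler_pdivlMr // -natrX -natrM ler_nat.
  by apply: leq_trans (bin_fact_le _ _); rewrite leq_mul2r KsD orbT.
have -> : #|D|%:R ^+ k / k`!%:R * a ^+ k = (#|D|%:R * a) ^+ k / k`!%:R :> R.
  by rewrite [in RHS]exprMn mulrAC.
apply: (@le_trans _ _ ((delta * m%:R) ^+ k / k`!%:R)).
  apply: ler_wpM2r; first by rewrite invr_ge0 ltW.
  apply: lerXn2r; [exact: mulr_ge0 | exact: mulr_ge0 |].
  apply: (@le_trans _ _ (delta * N%:R * a)); first exact: ler_wpM2r.
  have -> // : delta * N%:R * a = delta * m%:R.
  by rewrite /a; field; rewrite gt_eqF.
rewrite exprMn -mulrA; apply: ler_wpM2l; first exact: exprn_ge0.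
case: (k) => [|k']; last first.
  by have := @expR_ge1Dxn R m%:R k' (ler0n _ _); lra.
by rewrite expr0 fact0 divr1 -[leLHS]expR0 ler_expR.
Qed.

Lemma sum_subset_expr (Z : {set X}) (x : R) : 0 <= x ->
  \sum_(U : {set X} | U \subset Z) x ^+ #|U| <= (1 + x) ^+ #|Z|.
Proof.
move=> x0; pose F i : R := if i \in Z then x else 0.
have -> : (1 + x) ^+ #|Z| = \prod_i (F i + 1).
  rewrite -prodr_const big_mkcond; apply: eq_bigr => i _.
  by rewrite /F; case: ifP => _; rewrite ?add0r // addrC.
rewrite bigA_distr big_mkcond; apply: ler_sum => U _; case: ifP => [UZ|_].
  rewrite -prodr_const [leLHS]big_mkcond le_eqVlt; apply/orP; left; apply/eqP.
  apply: eq_bigr => i _; case: ifP => // iU.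
  by rewrite /F (subsetP UZ).
by apply: prodr_ge0 => i _; rewrite /F; do 2 case: ifP => //.
Qed.

(** A set U of size at most M is the union of at most 2^(M k) tuples of its subsets, which reduces
    the sum to one over sets. *)
Lemma sum_union_expr (Z : {set X}) k M (x : R) : 0 <= x ->
  \sum_(l : {ffun 'I_k -> {set X}} | (\bigcup_i l i \subset Z) &&
       (#|\bigcup_i l i| <= M)%N) x ^+ #|\bigcup_i l i|
    <= 2 ^+ (M * k) * (1 + x) ^+ #|Z|.
Proof.
move=> x0; pose un (l : {ffun 'I_k -> {set X}}) := \bigcup_i l i.
rewrite (partition_big un (fun U : {set X} => (U \subset Z) && (#|U| <= M)%N)) //=.
apply: (@le_trans _ _ (\sum_(U : {set X} | (U \subset Z) && (#|U| <= M)%N)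
    (2 ^+ (M * k) * x ^+ #|U|))).
  apply: ler_sum => U /andP[UZ UM].
  apply: (@le_trans _ _ (\sum_(l in ffun_on [in powerset U]) x ^+ #|U|)).
    rewrite [leLHS]big_mkcond [leRHS]big_mkcond; apply: ler_sum => l _.
    have xU : 0 <= x ^+ #|U| by exact: exprn_ge0.
    case: ifP => [/andP[_ /eqP e]|_]; last by case: ifP.
    rewrite -/(un l) e ifT //; apply/ffun_onP => i; rewrite powersetE -e.
    exact: bigcup_sup.
  rewrite sumr_const -[leLHS]mulr_natl ler_wpM2r ?exprn_ge0 //.
  rewrite card_ffun_on card_ord card_powerset -natrX ler_nat -expnM.
  by rewrite leq_exp2l // leq_mul2r UM orbT.
rewrite -mulr_sumr ler_wpM2l ?exprn_ge0 //.
apply: le_trans (sum_subset_expr Z x0).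
rewrite [leLHS]big_mkcond [leRHS]big_mkcond; apply: ler_sum => U _.
case: (U \subset Z) => //=; case: ifP => // _; exact: exprn_ge0.
Qed.

Lemma fingerprint_count (B : {set {set X}}) k M k0
    (D : {ffun 'I_k -> {set X}} -> {set X}) (delta : R) :
  0 <= delta -> B \subset uniform_class ->
  (forall l, D l \subset \bigcup_(f in E) Y f /\ #|D l|%:R <= delta * N%:R) ->
  (forall G, G \in B -> exists l : {ffun 'I_k -> {set X}},
     [/\ \bigcup_i l i \subset G, (#|\bigcup_i l i| <= M)%N &
         (k0 <= #|(G :&: D l) :\: \bigcup_i l i|)%N]) ->
  #|B|%:R <= 2 ^+ (M * k) * expR m%:R ^+ #|E|.+1 * delta ^+ k0 * 'C(N, m)%:R ^+ #|E|.
Proof.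
move=> d0 BU HD HB; set Z := \bigcup_(f in E) Y f in HD *.
set c := 'C(N, m)%:R ^+ #|E|; have c0 : 0 <= c by exact: exprn_ge0.
have q0 : 0 <= c * (delta ^+ k0 * expR m%:R).
  by rewrite mulr_ge0 // mulr_ge0 ?exprn_ge0 // expR_ge0.
pose cond (l : {ffun 'I_k -> {set X}}) := (\bigcup_i l i \subset Z) &&
       (#|\bigcup_i l i| <= M)%N.
apply: (@le_trans _ _ (\sum_(l | cond l)
   #|[set G in uniform_class | (\bigcup_i l i \subset G) &&
       (k0 <= #|(G :&: D l) :\: \bigcup_i l i|)%N]|%:R)).
  rewrite -natr_sum ler_nat; apply: leq_card_cover => G GB.
  have [l [lG lM kl]] := HB G GB; have GU := subsetP BU G GB.
  exists l; last by rewrite inE GU lG kl.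
  rewrite /cond lM andbT; apply: subset_trans lG _.
  by move: GU; rewrite inE => /andP[].
apply: (@le_trans _ _ (\sum_(l | cond l)
    (c * (delta ^+ k0 * expR m%:R) * a ^+ #|\bigcup_i l i|))).
  apply: ler_sum => l /andP[lZ _]; have [DZ Ds] := HD l.
  apply: (le_trans (card_uniform_dense _ lZ DZ d0 Ds)).
  by rewrite -/c mulrAC.
rewrite -mulr_sumr; apply: (le_trans (ler_wpM2l q0 (sum_union_expr Z k M a0))).
(* Here a N = m, so the total charge of all fingerprints is e^(m |E|), independent of N. *)
have hZ : (1 + a) ^+ #|Z| <= expR m%:R ^+ #|E|.
  have ZN : (#|Z| <= N * #|E|)%N.
    apply: (@leq_trans (\sum_(f in E) #|Y f|)).
      by apply: leq_card_cover => w /bigcupP[f fE wf]; exists f.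
    rewrite mulnC -sum_nat_const; exact: leq_sum.
  have h1 : 1 <= 1 + a by rewrite lerDl.
  apply: (@le_trans _ _ ((1 + a) ^+ (N * #|E|))); first by rewrite ler_weXn2l.
  rewrite exprM; apply: lerXn2r; rewrite ?nnegrE ?exprn_ge0 ?expR_ge0 //.
    by apply: le_trans h1.
  have -> : m%:R = N%:R * a.
    by rewrite mulrC /a mulfVK // pnatr_eq0 -lt0n.
  rewrite expRM_natl; apply: lerXn2r; rewrite ?nnegrE ?expR_ge0 //.
    by apply: le_trans h1.
  exact: expR_ge1Dx.
have -> : 2 ^+ (M * k) * expR m%:R ^+ #|E|.+1 * delta ^+ k0 * c =
   c * (delta ^+ k0 * expR m%:R) * (2 ^+ (M * k) * expR m%:R ^+ #|E|) :> R.
  by rewrite exprS; ring.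
apply: ler_wpM2l => //; apply: ler_wpM2l => //; exact: exprn_ge0.
Qed.

End Counting.

(** * The hypergraph of copies *)

Section Host.
Variables (V T : finType) (P : V -> {set T}) (n : nat) (F : {set {set V}}) (S : {set V}).
Variable GR : {set {set T}}.
Hypotheses (dP : disjoint_parts P n) (simpF : simple_graph F).
Let E := nonroot_edges F S.

Lemma simple_nonroot : simple_graph E.
Proof. by move=> f; rewrite inE => /andP[_ /simpF]. Qed.

Lemma nonroot_not_sub f : f \in E -> ~~ (f \subset S).
Proof. by rewrite !inE negb_and => /andP[/orP[/negPf->|]]. Qed.

Lemma simple_graph_edge (E' : {set {set V}}) f : simple_graph E' -> f \in E' ->
  exists i j, i != j /\ f = [set i; j].
Proof. by move=> simp /simp /eqP/cards2P[i [j [ij ->]]]; exists i, j. Qed.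

(* For an edge f = {i, j} these are the pairs between P i and P j, written without
   choosing an orientation of f. *)
Definition slots (f : {set V}) : {set {set T}} :=
  [set t : {set T} | (#|t| == 2) && [forall i in f, t :&: P i != set0]].

Lemma slots_pairs i j : i != j ->
  slots [set i; j] = edges_between [set: {set T}] (P i) (P j).
Proof.
have [_ disjP] := dP.
move=> ij; apply/setP => t; rewrite !inE /=; apply/andP/exists_inP.
  case=> /cards2P[a [b [ab ->]]] /forall_inP h.
  have /set0Pn[u] := h i (set21 i j); rewrite inE => /andP[ut uP].
  have /set0Pn[w] := h j (set22 i j); rewrite inE => /andP[wt wP].
  have uw : u != w by apply: contra ij => /eqP e; rewrite e in uP; rewrite (part_inj disjP uP wP).
  exists u => //; apply/exists_inP; exists w => //.
  rewrite eq_sym eqEcard !cards2 ab uw leqnn andbT.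
  by apply/subsetP => x; rewrite inE => /orP[]; rewrite inE => /eqP->.
case=> u uP /exists_inP[w wP /eqP->].
have uw : u != w by apply: contra ij => /eqP e; rewrite e in uP; rewrite (part_inj disjP uP wP).
split; first by rewrite cards2 uw.
apply/forall_inP => k; rewrite !inE => /orP[]/eqP->; apply/set0Pn.
  by exists u; rewrite inE set21.
by exists w; rewrite inE set22.
Qed.

Lemma card_slots f : f \in E -> (#|slots f| <= n ^ 2)%N.
Proof.
have [cardP disjP] := dP.
move=> /(simple_graph_edge simple_nonroot)[i [j [ij ->]]]; rewrite slots_pairs //.
rewrite (card_edges_between _ (disjP i j ij)).
apply: (@leq_trans #|setX (P i) (P j)|).
  by apply/subset_leq_card/subsetP => p; rewrite inE => /andP[].
by rewrite cardsX !cardP expnS expn1.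
Qed.

(* A copy is determined by v, which also determines the edge v @: S of GR; v
   indexes an edge of the container hypergraph, namely [edge_images E v]. *)
Definition host := copies E S [set: {set T}] GR P.

Lemma in_host v : (v \in host) = (v \in box P) && (v @: S \in GR).
Proof. by rewrite /host /copies in_set subsetT. Qed.

Lemma within_host C : within host (edge_images E) C = copies E S C GR P.
Proof.
apply/setP => v; rewrite in_within in_host /copies in_set.
by rewrite -andbA; congr (_ && _); rewrite andbC.
Qed.

Lemma host_uniform v : v \in host ->
  #|edge_images E v| = #|E| /\ edge_images E v \subset \bigcup_(f in E) slots f.
Proof.
have [_ disjP] := dP.
rewrite in_host => /andP[/in_box vP _].
have vinj := box_inj disjP vP.
split; first by rewrite card_imset //; exact: imset_inj.
apply/subsetP => _ /imsetP[f fE ->]; apply/bigcupP; exists f => //.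
rewrite inE card_imset // (simple_nonroot fE) eqxx /=.
apply/forall_inP => i fi; apply/set0Pn; exists (v i).
by rewrite inE vP imset_f.
Qed.

Lemma partite_copy_images v : v \in box P -> forall G : {set {set T}},
  edge_images E v \subset G -> partite_copy P E G v.
Proof.
move=> /in_box vP G sub; apply/andP; split; first exact/forallP.
apply/forallP => i; apply/forallP => j; apply/implyP => ij.
apply: (subsetP sub); apply/imsetP; exists [set i; j] => //.
by rewrite imsetU1 imset_set1.
Qed.

Lemma copies_le_edge_count (G : {set {set T}}) :
  (#|copies E S G GR P| <= copy_edge_count P F S G GR)%N.
Proof.
rewrite /copy_edge_count; apply: (@leq_trans (\sum_(e in GR)
    #|[set v : {ffun V -> T} | partite_copy P E G v & e \subset [set v i | i : V]]|)%N).
  apply: leq_card_cover => v; rewrite in_set => /andP[vP /andP[vG vS]].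
  exists (v @: S) => //; rewrite inE partite_copy_images //=.
  by apply: imsetS; apply/subsetP.
rewrite big_mkcond; apply: leq_sum => e _; rewrite /copy_multiplicity.
by case: ifP.
Qed.

Lemma regular_class_uniform (R : realType) (mu : R) m (G : {set {set T}}) :
  regular_class P E m mu G ->
  G \in uniform_class E slots m /\ regular_pairs P E m mu G.
Proof.
case=> reg sub; split => //; rewrite inE; apply/andP; split.
  apply/subsetP => e /sub[i [j [ijE eij]]]; apply/bigcupP; exists [set i; j] => //.
  have ij : i != j.
    by apply/eqP => e'; have := simple_nonroot ijE; rewrite e' setUid cards1.
  by rewrite slots_pairs //; move: eij; rewrite !inE => /andP[].
apply/forall_inP => f fE.
have [i [j [ij ef]]] := simple_graph_edge simple_nonroot fE.
rewrite ef in fE *; have [_ <-] := reg i j fE; apply/eqP.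
by rewrite slots_pairs //; apply: eq_card => e; rewrite !inE.
Qed.

(** A copy extending [v0] on D is determined by its hyperedge [v @: S], which contains the
    prescribed roots, and by its values outside of S and D; disjoint parts tell which root a vertex
    of the hyperedge belongs to. *)
Lemma extension_count (v0 : {ffun V -> T}) (D : {set V}) : v0 \in box P ->
  (#|[set v in host | [forall i in D, v i == v0 i]]| <=
   hyperdegree GR [set v0 i | i in S :&: D] * n ^ (#|V| - #|S :|: D|))%N.
Proof.
have [cardP disjP] := dP.
move=> /in_box v0P; set Z := [set v in host | _].
have inZ v : (v \in Z) = (v \in host) && [forall i in D, v i == v0 i].
  by rewrite [LHS]in_set.
pose A i := if i \in S :|: D then [set v0 i] else P i.
pose h (v : {ffun V -> T}) := (v @: S, [ffun i => if i \in S :|: D then v0 i else v i]).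
have hinj : {in Z &, injective h}.
  move=> v w; rewrite !inZ => /andP[vh /forall_inP vD] /andP[wh /forall_inP wD].
  move: vh wh; rewrite !in_host => /andP[/in_box vP _] /andP[/in_box wP _].
  case=> eS /ffunP eR; apply/ffunP => i.
  have [iD|iD] := boolP (i \in D).
    by rewrite (eqP (vD i iD)) (eqP (wD i iD)).
  have [iS|iS] := boolP (i \in S); last first.
    by have := eR i; rewrite !ffunE in_setU (negPf iS) (negPf iD).
  have : v i \in w @: S by rewrite -eS imset_f.
  case/imsetP => k kS e; rewrite e; congr (w _).
  by apply: (part_inj disjP (wP k)); rewrite -e.
have -> : (n ^ (#|V| - #|S :|: D|) = #|box A|)%N.
  rewrite card_box (bigID (mem (S :|: D))) /= big1 ?mul1n.
    rewrite (eq_bigr (fun _ => n)); last by move=> i /negPf iSD; rewrite /A iSD.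
    rewrite prod_nat_const -(cardC (mem (S :|: D))) addKn.
    by congr (n ^ _)%N; apply: eq_card.
  by move=> i iSD; rewrite /A iSD cards1.
rewrite -(card_in_imset hinj) /hyperdegree -cardsX.
apply: subset_leq_card; apply/subsetP => _ /imsetP[v + ->].
rewrite inZ in_host => /andP[/andP[/in_box vP vS] /forall_inP vD].
rewrite in_setX /= in_set vS /=; apply/andP; split.
  apply/subsetP => _ /imsetP[i + ->]; rewrite inE => /andP[iS iD].
  by rewrite -(eqP (vD i iD)) imset_f.
by apply/in_box => i; rewrite ffunE /A; case: ifP => //; rewrite set11.
Qed.

(** One copy [v0] above Ts identifies Ts with a set J of edges of F_-. As each vertex reveals its
    part, every other copy above Ts agrees with [v0] on [cover J]. *)
Lemma above_host (Ts : {set {set T}}) (v0 : {ffun V -> T}) :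
  v0 \in above host (edge_images E) Ts ->
  exists J : {set {set V}}, [/\ J \subset E, #|J| = #|Ts| &
    (#|above host (edge_images E) Ts| <=
     hyperdegree GR [set v0 i | i in S :&: cover J] *
       n ^ (#|V| - #|S :|: cover J|))%N].
Proof.
have [_ disjP] := dP.
rewrite in_above in_host => /andP[/andP[v0b v0S] Tsub].
have v0P := in_box _ _ v0b.
have v0inj : injective (fun f : {set V} => v0 @: f).
  by apply: imset_inj; apply: (box_inj disjP); exact/in_box.
pose J := [set f in E | v0 @: f \in Ts].
have eT : Ts = [set v0 @: (f : {set V}) | f in J].
  apply/setP => t; apply/idP/imsetP => [tT|[f + ->]]; last by rewrite inE => /andP[].
  have /imsetP[f fE et] := subsetP Tsub t tT.
  by exists f => //; rewrite inE fE -et.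
exists J; split.
- by apply/subsetP => f; rewrite inE => /andP[].
- by rewrite [in RHS]eT card_imset.
apply: leq_trans (extension_count (cover J) v0b); apply: subset_leq_card.
apply/subsetP => v; rewrite in_above => /andP[vh vT]; rewrite [X in is_true X]in_set vh /=.
apply/forall_inP => i /bigcupP[f fJ fi].
have : v0 @: f \in Ts by rewrite eT imset_f.
move/(subsetP vT)/imsetP => [f' f'E e].
have : v0 i \in v @: f' by rewrite -e imset_f.
case/imsetP => k kf' e'; rewrite e'.
move: vh; rewrite in_host => /andP[/in_box vP _].
suff -> : i = k by [].
by apply: (part_inj disjP (x := v0 i)); [exact: (in_box P v0 v0b) | rewrite e'].
Qed.

End Host.

(** * From the rooted 2-density to codegrees *)

Section RootedDensityBound.
Variables (R : realType) (V : finType) (F : {set {set V}}) (S : {set V}).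
Hypothesis simpF : simple_graph F.

Lemma card_cover_ge2 (J : {set {set V}}) : simple_graph J -> (0 < #|J|)%N ->
  (1 < #|cover J|)%N.
Proof.
move=> simpJ /card_gt0P[f fJ]; rewrite -(simpJ f fJ) subset_leq_card //.
exact: bigcup_sup.
Qed.

(** The density is evaluated at the graph on [cover J] with edge set [J :|: K]; no edge of J lies in
    S, so K is its set of root edges. A denominator that is not positive would make [m2]
    infinite. *)
Lemma m2_bound (t : R) (J K : {set {set V}}) : J \subset nonroot_edges F S ->
  K \subset induced_edges F (S :&: cover J) -> (1 < #|J|)%N ->
  m2 S F t != +oo%E ->
  0 <= fine (m2 S F t)^-1%E /\
  (#|J|%:R - 1) * fine (m2 S F t)^-1%E <= #|cover J|%:R - 2 - t * #|K|%:R.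
Proof.
move=> JE KI J2 Mfin.
have dJK : [disjoint J & K].
  rewrite disjoints_subset; apply/subsetP => f /(subsetP JE)/nonroot_not_sub fS.
  rewrite inE; apply: contra fS => /(subsetP KI); rewrite inE => /andP[_].
  by rewrite subsetI => /andP[].
pose H := (cover J, J :|: K).
have rootH : root_edges S H = K.
  apply/setP => e; rewrite /root_edges /H /= !inE; apply/andP/idP.
    case=> /orP[/(subsetP JE)/nonroot_not_sub eS|//].
    by rewrite subsetI (negPf eS).
  by move=> eK; rewrite eK orbT; have := subsetP KI e eK; rewrite inE => /andP[].
have cardH : #|H.2| = (#|J| + #|K|)%N.
  by apply/eqP; rewrite (leq_card_setU J K).
have HF : is_subgraph F H && (1 < #|H.2| - #|root_edges S H|)%N.
  rewrite rootH cardH addnK J2 andbT; apply/andP; split.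
    rewrite subUset; apply/andP; split.
      by apply: subset_trans JE _; exact: subsetDl.
    by apply: subset_trans KI _; apply/subsetP => e; rewrite inE => /andP[].
  apply/forall_inP => e; rewrite inE => /orP[eJ|/(subsetP KI)].
    exact: bigcup_sup.
  by rewrite inE subsetI => /andP[_ /andP[]].
have dM : (d2 S H t <= m2 S F t)%E by rewrite /m2; exact: le_bigmax_cond.
have num0 : 0 < #|J|%:R - 1 :> R by rewrite subr_gt0 ltr1n.
move: dM; rewrite /d2 rootH cardH natrD addrK /=.
case: ifP => [den0|_]; last by rewrite leye_eq (negPf Mfin).
case: (m2 S F t) Mfin => [r _|/eqP//|_]; last by rewrite leeNy_eq.
rewrite lee_fin => dr.
have r0 : 0 < r by apply: lt_le_trans dr; exact: divr_gt0.
rewrite fine_invr invr_ge0 ltW //; split => //.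
by rewrite ler_pdivrMr // -ler_pdivrMl // mulrC.
Qed.

(** With q = n^(-t), this is [m2_bound] read in the exponent of n. *)
Lemma extension_density (n : nat) (q x : R) (J : {set {set V}}) :
  let t := - (ln q / ln n%:R) in let K := induced_edges F (S :&: cover J) in
  (1 < n)%N -> 0 < q -> m2 S F t != +oo%E ->
  n%:R `^ (- fine (m2 S F t)^-1%E) <= x ->
  J \subset nonroot_edges F S -> (0 < #|J|)%N ->
  1 <= q ^+ #|K| * n%:R ^+ (#|cover J| - 2) * x ^+ #|J|.-1.
Proof.
move=> t K n1 q0 Mfin xge JE J0.
have simpJ : simple_graph J by move=> f /(subsetP JE); rewrite inE => /andP[_ /simpF].
have cov2 := card_cover_ge2 simpJ J0.
have n1R : 1 < n%:R :> R by rewrite ltr1n.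
have n0R : 0 < n%:R :> R by apply: lt_trans n1R.
have lnn : 0 < ln n%:R :> R by exact: ln_gt0.
(* [m2] ranges over subgraphs with at least two non-root edges. A single edge covers two vertices,
   not both in S, so K is empty and the right-hand side is 1. *)
have [J1|J1] := eqVneq #|J| 1%N.
  have /cards1P[f Jf] := introT eqP J1.
  have fE : f \in nonroot_edges F S by apply: (subsetP JE); rewrite Jf set11.
  have covf : cover J = f by rewrite /cover Jf big_set1.
  have cf : #|f| = 2%N by apply: simpJ; rewrite Jf set11.
  have -> : K = set0.
    apply/setP => e; rewrite !inE covf; apply/negP => /andP[eF].
    rewrite subsetI => /andP[eS ef]; have /negP := nonroot_not_sub fE; apply.
    suff <- : e = f by [].
    by apply/eqP; rewrite eqEcard ef cf (simpF eF).
  by rewrite covf cf J1 cards0 !expr0 !mulr1.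
have J2 : (1 < #|J|)%N by rewrite ltn_neqAle eq_sym J1.
have [im0 im] := m2_bound JE (subxx _) J2 Mfin; set im2 := fine _ in im0 im xge.
have nt : n%:R `^ (- t) = q.
  rewrite /powR gt_eqF // /t opprK mulfVK ?gt_eqF //.
  by rewrite lnK.
have e1 : q ^+ #|K| * n%:R ^+ (#|cover J| - 2) =
    n%:R `^ (#|cover J|%:R - 2 - t * #|K|%:R).
  rewrite -[in LHS]nt -powR_mulrn; last by rewrite powR_ge0.
  rewrite -powRrM -powR_mulrn ?ltW // -powRD; last by rewrite (gt_eqF n0R) implybT.
  by rewrite natrB // -/K; congr (_ `^ _); ring.
rewrite e1; apply: (@le_trans _ _ (n%:R `^ ((#|J|%:R - 1) * im2) *
    (n%:R `^ (- im2)) ^+ #|J|.-1)).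
  rewrite -powR_mulrn ?powR_ge0 // -powRrM -powRD; last by rewrite (gt_eqF n0R) implybT.
  have -> : #|J|.-1%:R = #|J|%:R - 1 :> R by rewrite -subn1 natrB.
  by have -> : (#|J|%:R - 1) * im2 + - im2 * (#|J|%:R - 1) = 0 by [ring]; rewrite powRr0.
apply: ler_pM; rewrite ?powR_ge0 ?exprn_ge0 ?powR_ge0 //.
  by apply: ler_powR => //; exact: ltW.
by apply: lerXn2r; rewrite ?nnegrE ?powR_ge0 //; apply: le_trans xge; exact: powR_ge0.
Qed.

End RootedDensityBound.

(** Upper extensibility bounds the number of extensions in terms of J; multiplying by the factor
    from [extension_density], which is at least 1, removes the dependence on the shape of J. *)
Lemma host_codegree (R : realType) (V T : finType) (P : V -> {set T}) (n : nat)
    (F : {set {set V}}) (S : {set V}) (GR : {set {set T}}) (A q x : R) :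
  let t := - (ln q / ln n%:R) in let E := nonroot_edges F S in
  let eR := #|induced_edges F S| in
  disjoint_parts P n -> simple_graph F -> (1 < n)%N -> 0 < q -> 1 <= A ->
  upper_extensible P F S n (A * q) GR -> m2 S F t != +oo%E ->
  n%:R `^ (- fine (m2 S F t)^-1%E) <= x ->
  forall Ts : {set {set T}}, Ts != set0 ->
  #|above (host P F S GR) (edge_images E) Ts|%:R <=
    A ^+ eR * q ^+ eR * n%:R ^+ (#|V| - 2) * x ^+ #|Ts|.-1.
Proof.
move=> t E eR dP simpF n1 q0 A1 upp Mfin xge Ts Ts0.
have [cardP disjP] := dP.
have A0 : 0 < A by apply: lt_le_trans A1.
have x0 : 0 <= x by apply: le_trans xge; exact: powR_ge0.
have [->|/set0Pn[v0 v0a]] := eqVneq (above (host P F S GR) (edge_images E) Ts) set0.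
  by rewrite cards0; do !apply: mulr_ge0 => //; apply: exprn_ge0 => //; exact: ltW.
have [J [JE JTs le]] := above_host dP v0a.
have J0 : (0 < #|J|)%N by rewrite JTs card_gt0.
have simpJ : simple_graph J by move=> f /(subsetP JE); rewrite inE => /andP[_ /simpF].
have cov2 := card_cover_ge2 simpJ J0.
have dens := extension_density simpF n1 q0 Mfin xge JE J0.
set K := induced_edges F (S :&: cover J) in dens.
have KS : (#|K| <= eR)%N.
  apply: subset_leq_card; apply/subsetP => e; rewrite !inE subsetI.
  by case/andP => -> /andP[->].
have v0P i : v0 i \in P i.
  by move: v0a; rewrite in_above in_host => /andP[/andP[/in_box]].
have hyp := upp (S :&: cover J) v0 (subsetIl _ _) (fun i _ => v0P i).
apply: (@le_trans _ _ ((A * q) ^+ (eR - #|K|) * n%:R ^+ (#|V| - #|cover J|))).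
  apply: (@le_trans _ _ ((hyperdegree GR [set v0 i | i in S :&: cover J])%:R *
      n%:R ^+ (#|V| - #|S :|: cover J|))).
    by rewrite -natrX -natrM ler_nat.
  have -> : (#|V| - #|cover J| =
      (#|S| - #|S :&: cover J|) + (#|V| - #|S :|: cover J|))%N.
    have h1 : (#|S :|: cover J| <= #|V|)%N by exact: max_card.
    have h2 : (#|S :&: cover J| <= #|S|)%N by rewrite subset_leq_card ?subsetIl.
    have h4 : (#|cover J| <= #|V|)%N by exact: max_card.
    have h3 := cardsUI S (cover J).
    move: h1 h2 h3 h4; clear; lia.
  rewrite exprD mulrA; apply: ler_wpM2r; first exact: exprn_ge0.
  exact: hyp.
have c0 : 0 <= (A * q) ^+ (eR - #|K|) * n%:R ^+ (#|V| - #|cover J|).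
  by rewrite mulr_ge0 ?exprn_ge0 // mulr_ge0 // ltW.
rewrite -[leLHS]mulr1; apply: (le_trans (ler_wpM2l c0 dens)).
rewrite JTs.
have -> : (A * q) ^+ (eR - #|K|) * n%:R ^+ (#|V| - #|cover J|) *
    (q ^+ #|K| * n%:R ^+ (#|cover J| - 2) * x ^+ #|Ts|.-1) =
    A ^+ (eR - #|K|) * (q ^+ eR * n%:R ^+ (#|V| - 2) * x ^+ #|Ts|.-1).
  have gen a k v c (y : R) : (A * q) ^+ a * n%:R ^+ v * (q ^+ k * n%:R ^+ c * y) =
      A ^+ a * (q ^+ (a + k) * n%:R ^+ (v + c) * y).
    by rewrite exprMn !exprD -!mulrA; congr (_ * (_ * _)); rewrite mulrCA.
  by rewrite gen subnK // addnBA // subnK // max_card.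
rewrite -!mulrA; apply: ler_wpM2r.
  by do !apply: mulr_ge0; apply: exprn_ge0 => //; exact: ltW.
by rewrite ler_weXn2l // leq_subr.
Qed.

(** * Numerical estimates and the final count *)

Lemma fingerprint_bound (R : realType) (beta x : R) (s m r Q k0 : nat) :
  0 < x -> x <= 1 -> 2 * expR 1 ^+ r * x <= beta -> (s <= m)%N ->
  (m <= Q * k0)%N ->
  2 ^+ s * expR m%:R ^+ r * (x ^+ Q) ^+ k0 <= beta ^+ m.
Proof.
move=> x0 x1 xb sm mQ.
have e0 : 0 <= expR 1 ^+ r :> R by rewrite exprn_ge0 // expR_ge0.
apply: (@le_trans _ _ ((2 * expR 1 ^+ r * x) ^+ m)); last first.
  have y0 : 0 <= 2 * expR 1 ^+ r * x by rewrite !mulr_ge0 // ltW.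
  by apply: lerXn2r => //; rewrite nnegrE; exact: le_trans xb.
have -> : expR m%:R = expR 1 ^+ m :> R by rewrite -expRM_natr mul1r.
rewrite !exprMn exprAC -(exprM x); apply: ler_pM.
- by rewrite mulr_ge0 ?exprn_ge0 // ?expR_ge0.
- by rewrite exprn_ge0 // ltW.
- by apply: ler_wpM2r; [exact: exprn_ge0 | rewrite ler_weXn2l // ler1n].
- by rewrite ler_wiXn2l // ltW.
Qed.

Lemma nth_finfun_seq (T : Type) (x0 : T) (s : seq T) k : size s = k ->
  [seq [ffun i : 'I_k => nth x0 s i] i | i <- enum 'I_k] = s.
Proof.
move=> sk; rewrite (eq_map (g := fun i : 'I_k => nth x0 s i)); last first.
  by move=> i; rewrite ffunE.
by rewrite (map_comp (nth x0 s) val) val_enum_ord -sk; exact: mkseq_nth.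
Qed.

(** Two edges cover at most 4 vertices. The bound gives n^(2 - 1/m_2) >= 1 and hence
    [alpha * m >= 1]. *)
Lemma m2_inv_le2 (R : realType) (V : finType) (F : {set {set V}}) (S : {set V})
    (t : R) : simple_graph F -> (1 < #|nonroot_edges F S|)%N ->
  m2 S F t != +oo%E -> fine (m2 S F t)^-1%E <= 2.
Proof.
move=> simpF E2 Mfin.
have [J] : exists J : {set {set V}},
    J \in [set J : {set {set V}} | J \subset nonroot_edges F S & #|J| == 2%N].
  by apply/set0Pn; rewrite -card_gt0 cards_draws bin_gt0.
rewrite inE => /andP[JE /eqP J2].
have [] := @m2_bound R V F S t J set0 JE (sub0set _) _ Mfin; first by rewrite J2.
have cov : (#|cover J| <= 4)%N.
  apply: (@leq_trans (\sum_(f in J) #|f|)).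
    by apply: leq_card_cover => i /bigcupP[f fJ fi]; exists f.
  rewrite (eq_bigr (fun _ => 2%N)) ?sum_nat_const ?J2 //.
  by move=> f /(subsetP JE); rewrite inE => /andP[_ /simpF].
rewrite J2 cards0 mulr0; have : #|cover J|%:R <= 4 :> R by rewrite ler_nat.
lra.
Qed.

Lemma card_bigcup_ord (X : finType) (k b : nat) (l : 'I_k -> {set X}) :
  (forall i, #|l i| <= b)%N -> (#|\bigcup_i l i| <= k * b)%N.
Proof.
move=> lb; apply: (@leq_trans (\sum_(i < k) #|l i|)).
  by apply: leq_card_cover => x /bigcupP[i _ xi]; exists i.
by rewrite -[k in (k * b)%N]card_ord -sum_nat_const leq_sum.
Qed.

(** A fingerprint of total size k b must cost at most m / (4Q) edges of G, and the 2^(k b k) tuples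
    with a given union must cost at most 2^m. *)
Lemma fingerprint_sizes (R : realType) (gam m k Q b : R) :
  0 <= gam -> 0 <= m -> 1 <= Q -> 0 <= k -> b <= 2 * (gam * m) ->
  gam * (8 * (k + 1) ^+ 2 * Q) <= 1 -> 4 * (k * b) * Q <= m /\ k * b * k <= m.
Proof.
move=> g0 m0 Q1 k0 bm gk.
have Q0 : 0 <= Q by apply: le_trans Q1.
have k1 : 1 <= (k + 1) ^+ 2 by rewrite exprn_ege1 // lerDr.
have k20 : 0 <= k ^+ 2 by exact: exprn_ge0.
have ek : (k + 1) ^+ 2 = k ^+ 2 + 2 * k + 1 by ring.
have kk : k <= (k + 1) ^+ 2 by rewrite ek; lra.
have kk2 : k ^+ 2 <= (k + 1) ^+ 2 by rewrite ek; lra.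
have bnd y : 0 <= y -> y <= 8 * (k + 1) ^+ 2 * Q -> gam * m * y <= m.
  move=> y0 yk; rewrite mulrAC -[leRHS]mul1r; apply: ler_wpM2r => //.
  by apply: le_trans gk; apply: ler_wpM2l.
split.
- apply: le_trans (bnd (8 * (k * Q)) _ _).
  + have := ler_wpM2l (mulr_ge0 k0 Q0) bm.
    by clear; lra.
  + by rewrite mulr_ge0 // mulr_ge0.
  + by rewrite -mulrA ler_pM2l // ler_wpM2r.
- apply: le_trans (bnd (2 * k ^+ 2) _ _).
  + have := ler_wpM2l (mulr_ge0 k0 k0) bm.
    by rewrite expr2; clear; lra.
  + by rewrite mulr_ge0 // exprn_ge0.
  + have : (k + 1) ^+ 2 * 1 <= (k + 1) ^+ 2 * Q by rewrite ler_wpM2l // (le_trans _ k1).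
    by move: k1 kk2; nra.
Qed.

Theorem theorem1p13 (R : realType) (V : finType) (F : {set {set V}})
    (hF : simple_graph F) (roots : seq V) (hroots : uniq roots) :
  let S : {set V} := [set i in roots] in
  let eFm := #|nonroot_edges F S| in
  let eFR := #|induced_edges F S| in
  (1 < eFm)%N ->
  forall beta : R, 0 < beta ->
  exists2 mu : R, 0 < mu &
  forall A : R, 1 <= A ->
  exists2 alpha : R, 0 < alpha &
  forall q : nat -> R, (forall n, 0 < q n) ->
  (q n @[n --> \oo] --> (0 : R))%classic ->
  exists n0 : nat, forall n : nat, (n0 <= n)%N ->
  forall (T : finType) (P : V -> {set T}), disjoint_parts P n ->
  forall (m : nat) (GR : {set {set T}}),
  alpha^-1
    * n%:R `^ (2 - fine (m2 S F (- (ln (q n) / ln n%:R)))^-1%E) <= m%:R ->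
  partite_hypergraph P S GR ->
  upper_extensible P F S n (A * q n) GR ->
  lower_regular P F S (q n) mu GR ->
  #|[set G : {set {set T}} |
      `[< regular_class P (nonroot_edges F S) m mu G /\
          (copy_edge_count P F S G GR)%:R
            < alpha * (m%:R / n%:R ^+ 2) ^+ eFm * q n ^+ eFR
              * n%:R ^+ #|V| >]]|%:R
  <= beta ^+ m * ('C(n ^ 2, m))%:R ^+ (#|F| - eFR).
Proof.
move=> S eFm eFR eFm1 beta beta0.
pose E := nonroot_edges F S; pose r := #|E|.
have simpE : simple_graph E := simple_nonroot hF.
have v2 : (2 <= #|V|)%N.
  apply: (@leq_trans #|cover E|); last exact: max_card.
  by apply: card_cover_ge2 => //; apply: ltnW.
have V0 : (0 < #|V|)%N := ltnW v2.
have VR : 0 < #|V|%:R :> R by rewrite ltr0n.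
have r0 : (0 < r)%N := ltnW eFm1.
have rR : 1 <= r%:R :> R by rewrite ler1n.
have ex0 : 0 < 2 * expR 1 ^+ r.+1 :> R.
  by rewrite mulr_gt0 // exprn_gt0 // expR_gt0.
(* The final count loses 2^m for tuples and e^(m(r + 1)) in the union bound; x0^m has to compensate
   for both. *)
pose x0 : R := Num.min 1 (beta / (2 * expR 1 ^+ r.+1)).
have x00 : 0 < x0 by rewrite /x0 lt_min ltr01 divr_gt0.
have x01 : x0 <= 1 by rewrite /x0 ge_min lexx.
have x0b : 2 * expR 1 ^+ r.+1 * x0 <= beta.
  by rewrite mulrC -ler_pdivlMr // /x0 ge_min lexx orbT.
(* A regular G has at least 2m / Q edges in the sparse slice, of which at least
   m / Q survive outside of the fingerprint, so that delta ^ (m / Q) = x0 ^ m. *)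
pose Q := (16 * #|V| ^ 2)%N.
have Q0 : (0 < Q)%N by rewrite muln_gt0 expn_gt0 V0.
have QR : 0 < Q%:R :> R by rewrite ltr0n.
pose delta := x0 ^+ Q.
have delta0 : 0 < delta by exact: exprn_gt0.
have delta1 : delta <= 1 by rewrite exprn_ile1 // ltW.
have [mu /andP[mu0 mu12] [g0 g00 sparse]] := sparse_pair delta0 delta1 V0.
exists mu => // A A1.
have A0 : 0 < A by exact: lt_le_trans A1.
(* [A ^+ eFR] comes from upper extensibility, r from N = r n^2, and 1 / g0 from measuring codegrees
   against [E0], which is g0 q^eFR n^|V|. *)
pose K := 1 + A ^+ eFR * r%:R / g0.
have K1 : 1 <= K.
  rewrite /K lerDl divr_ge0 ?mulr_ge0 ?exprn_ge0 // ltW //.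
have [c c0 [xi xi0 [k cont]]] := iterated_containers r0 K1.
pose gam : R := Num.min (c / 2) (8 * k.+1%:R ^+ 2 * Q%:R)^-1.
have kR : 0 < k.+1%:R :> R by rewrite ltr0n.
have gam0 : 0 < gam by rewrite /gam lt_min; apply/andP; split; pos.
have gamc : gam <= c / 2 by rewrite /gam ge_min lexx.
have gamk : gam * (8 * k.+1%:R ^+ 2 * Q%:R) <= 1.
  rewrite -ler_pdivlMr; last pos.
  by rewrite div1r /gam ge_min lexx orbT.
have rR0 : 0 < r%:R :> R by exact: lt_le_trans rR.
(* In this order: the container scale x is at least n^(-1/m_2) and gam m >= 1; m >= 2Q; few copies
   in T(G, G_R) meet the container hypothesis; and [m2] is finite. *)
pose alpha : R := Num.min (Num.min (gam / r%:R) (2 * Q%:R)^-1)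
                   (Num.min (xi * g0 * (gam / r%:R) ^+ r) 2^-1).
have alpha0 : 0 < alpha by rewrite /alpha !lt_min; do ![apply/andP; split]; pos.
have al1 : alpha <= gam / r%:R by rewrite /alpha !ge_min lexx.
have al2 : alpha <= (2 * Q%:R)^-1 by rewrite /alpha !ge_min lexx orbT.
have al3 : alpha <= xi * g0 * (gam / r%:R) ^+ r.
  by rewrite /alpha !ge_min lexx !orbT.
have al4 : alpha <= 2^-1 by rewrite /alpha !ge_min lexx !orbT.
exists alpha => // q q0 _; exists 2%N => n n1 T P dP m GR mlow part upp low.
have [cardP disjP] := dP.
set B := [set G : {set {set T}} | _].
have classB G : G \in B -> [/\ G \in uniform_class E (slots P) m,
    regular_pairs P E m mu G & #|copies E S G GR P|%:R <
      alpha * (m%:R / n%:R ^+ 2) ^+ r * q n ^+ eFR * n%:R ^+ #|V|].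
  rewrite inE => /asboolP[reg few].
  have [uc rp] := regular_class_uniform dP hF reg; split => //.
  by apply: le_lt_trans few; rewrite ler_nat; exact: copies_le_edge_count.
have rhs0 : 0 <= beta ^+ m * 'C(n ^ 2, m)%:R ^+ (#|F| - eFR).
  by rewrite mulr_ge0 // exprn_ge0 // ltW.
have [mn|mn] := ltnP (n ^ 2) m.
  suff -> : B = set0 by rewrite cards0.
  apply/setP => G; rewrite in_set0; apply/negP => /classB[uc _ _].
  have [f fE] := card_gt0P r0; move: uc; rewrite inE => /andP[_ /forall_inP/(_ f fE)/eqP e].
  have : (#|G :&: slots P f| <= n ^ 2)%N.
    by apply: leq_trans (card_slots dP hF fE); rewrite subset_leq_card // subsetIr.
  by rewrite e leqNgt mn.
pose t : R := - (ln (q n) / ln n%:R).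
have nR1 : 1 <= n%:R :> R by rewrite ler1n ltnW.
have nR : 0 < n%:R :> R by exact: lt_le_trans nR1.
have n2R : 0 < n%:R ^+ 2 :> R by exact: exprn_gt0.
set im2 := fine (m2 S F t)^-1%E.
have {}mlow : alpha^-1 * n%:R `^ (2 - im2) <= m%:R := mlow.
have mnR : m%:R <= n%:R ^+ 2 :> R by rewrite -natrX ler_nat.
(* An infinite [m2] would give m >= n^2 / alpha >= 2 n^2. *)
have Mfin : m2 S F t != +oo%E.
  apply/eqP => Moo; move: mlow; rewrite /im2 Moo invey /= subr0 (powR_mulrn _ (ltW nR)).
  rewrite ler_pdivrMl // => h.
  have : n%:R ^+ 2 <= 2^-1 * n%:R ^+ 2 :> R.
    by apply: (le_trans h); apply: ler_pM => //; exact: ltW.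
  by move: n2R; clear; lra.
have im2le : im2 <= 2 by exact: m2_inv_le2.
have malpha : 1 <= alpha * m%:R.
  rewrite -ler_pdivrMl // mulr1; apply: le_trans mlow.
  rewrite -[leLHS]mulr1 ler_pM2l ?invr_gt0 //.
  by rewrite -[leLHS](powRr0 n%:R) ler_powR // subr_ge0.
have algam : alpha <= gam.
  by apply: (le_trans al1); rewrite ler_pdivrMr // -[leLHS]mulr1 ler_pM2l.
have m0 : 0 <= m%:R :> R by [].
have gm1 : 1 <= gam * m%:R.
  by apply: (le_trans malpha); rewrite ler_wpM2r.
pose b := (Num.truncn (gam * m%:R)).+1.
have bge : gam * m%:R <= b%:R by rewrite ltW // Num.Theory.truncnS_gt.
have ble : b%:R <= 2 * (gam * m%:R).
  have : (Num.truncn (gam * m%:R))%:R <= gam * m%:R.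
    by rewrite Num.Theory.truncn_le // mulr_ge0 // ltW.
  by rewrite /b -natr1; move: gm1; clear; lra.
pose N : R := r%:R * n%:R ^+ 2.
have N0 : 0 < N by exact: mulr_gt0.
have b0 : (0 < b)%N by [].
have bR : 0 < b%:R :> R by rewrite ltr0n.
have bcN : b%:R <= c * N.
  apply: (le_trans ble).
  apply: (@le_trans _ _ (c * n%:R ^+ 2)).
    rewrite mulrA; apply: ler_pM => //; first by rewrite mulr_ge0 // ltW.
    by move: gamc; clear; lra.
  by rewrite ler_pM2l // -[leLHS]mul1r ler_pM2r.
pose x := b%:R / N.
have x1 : gam / r%:R * (m%:R / n%:R ^+ 2) <= x.
  rewrite /x ler_pdivlMr // /N.
  have -> : gam / r%:R * (m%:R / n%:R ^+ 2) * (r%:R * n%:R ^+ 2) = gam * m%:R.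
    by field; rewrite !gt_eqF.
  exact: bge.
have xge : n%:R `^ (- im2) <= x.
  apply: le_trans x1.
  apply: (@le_trans _ _ (alpha * (m%:R / n%:R ^+ 2))); last first.
    by apply: ler_wpM2r => //; apply: divr_ge0 => //; exact: ltW.
  rewrite mulrA ler_pdivlMr // -ler_pdivrMl // -(powR_mulrn _ (ltW nR)).
  rewrite -powRD; last by rewrite (gt_eqF nR) implybT.
  by rewrite addrC.
pose E0 := q n ^+ eFR * (g0 * n%:R ^+ #|V|).
have qn0 : 0 < q n by [].
have E00 : 0 < E0 by rewrite /E0; pos.
pose Y := \bigcup_(f in E) slots P f.
have YN : #|Y|%:R <= N.
  rewrite /N -natrX -natrM ler_nat.
  apply: (@leq_trans (\sum_(f in E) #|slots P f|)).
    by apply: leq_card_cover => w /bigcupP[f fE wf]; exists f.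
  by rewrite -sum_nat_const; apply: leq_sum => f; exact: card_slots.
have codeg (Ts : {set {set T}}) : Ts != set0 ->
    #|above (host P F S GR) (edge_images E) Ts|%:R <= K * x ^+ #|Ts|.-1 * E0 / N.
  move=> Ts0; apply: (le_trans (host_codegree dP hF n1 qn0 A1 upp Mfin xge Ts0)).
  have eE : K * x ^+ #|Ts|.-1 * E0 / N =
      (K * g0 / r%:R) * (q n ^+ eFR * n%:R ^+ (#|V| - 2) * x ^+ #|Ts|.-1).
    have gen (a1 a2 a3 a4 a5 a6 a7 : R) : a6 != 0 -> a7 != 0 ->
        a1 * a2 * (a3 * (a4 * (a5 * a6))) / (a7 * a6) =
        a1 * a4 / a7 * (a3 * a5 * a2).
      by move=> h1 h2; field; rewrite h1 h2.
    by rewrite /E0 /N -[in n%:R ^+ #|V|](subnK v2) exprD gen ?gt_eqF.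
  rewrite eE; apply: (@le_trans _ _ (A ^+ eFR *
    (q n ^+ eFR * n%:R ^+ (#|V| - 2) * x ^+ #|Ts|.-1))).
    by rewrite !mulrA.
  apply: ler_wpM2r.
    by rewrite !mulr_ge0 ?exprn_ge0 // ltW // divr_gt0.
  by rewrite ler_pdivlMr // /K mulrDl mul1r mulfVK ?gt_eqF // lerDr ltW.
have [g Hg] := cont _ _ b N E0 (host P F S GR) (edge_images E) Y N0 E00 b0 bcN YN
  (fun v vh => host_uniform dP hF vh) codeg.
pose C (l : {ffun 'I_k -> {set {set T}}}) := g [seq l i | i <- enum 'I_k].
(* D is the part of the container over its sparse slice: edges of a regular G over the slice lie in
   D or outside of the container. *)
pose good l (D : {set {set T}}) := [/\ D \subset Y, #|D|%:R <= delta * (n ^ 2)%:R &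
  forall G, G \in B -> #|within (host P F S GR) (edge_images E) (C l)|%:R < E0 ->
    m%:R / (8 * #|V|%:R ^+ 2) <= #|G :&: D|%:R + #|G :\: C l|%:R :> R].
have lowrho W : (forall i, i \in S -> eps_subset mu (W i) (P i)) ->
    q n ^+ eFR * \prod_(i in S) #|W i|%:R <=
    #|[set e in GR | e \subset \bigcup_(i in S) W i]|%:R := low W.
have q0' : 0 <= q n ^+ eFR by rewrite exprn_ge0 // ltW.
have n0 : (0 < n)%N := ltnW n1.
have /boolp.choice[D HD] : forall l, exists D, good l D.
  move=> l; have [few|many] := ltP #|within (host P F S GR) (edge_images E) (C l)|%:R E0;
    last first.
    (* D must be defined for every tuple; when the container spans at least [E0] copies, the last
       clause is void. *)
    exists set0; split; rewrite ?sub0set ?cards0 //.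
      by rewrite mulr_ge0 // ltW.
    by move=> G _; rewrite ltNge many.
  rewrite within_host in few.
  have [i [j [L [ijE LP Lbig Lsparse Lreg]]]] :=
    sparse T P n E S (C l) GR (q n ^+ eFR) dP n0 simpE
      (fun f fE => nonroot_not_sub fE) part q0' lowrho few.
  have ij : i != j.
    by apply/eqP => e; have := simpE _ ijE; rewrite e setUid cards1.
  pose EL := [set [set p.1; p.2] | p in L].
  have cardEL G : #|G :&: EL| = #|lpairs G L| := card_pair_image G (disjP i j ij) LP.
  have Ln : #|L|%:R <= (n ^ 2)%:R :> R.
    by rewrite ler_nat; apply: leq_trans (subset_leq_card LP) _; rewrite cardsX !cardP expnS expn1.
  exists (C l :&: EL); split.
  - apply/subsetP => e; rewrite inE => /andP[_ /imsetP[p pL ->]].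
    apply/bigcupP; exists [set i; j] => //; rewrite (slots_pairs dP ij) !inE /=.
    have := subsetP LP p pL; rewrite inE => /andP[p1 p2].
    by apply/exists_inP; exists p.1 => //; apply/exists_inP; exists p.2.
  - by rewrite cardEL; apply: (le_trans Lsparse); rewrite ler_pM2l.
  - move=> G /classB[_ reg _] _; have := Lreg m G reg; rewrite -cardEL.
    have cov : (#|G :&: EL| <= #|G :&: (C l :&: EL)| + #|G :\: C l|)%N.
      rewrite -(cardsID (C l) (G :&: EL)); apply: leq_add; apply: subset_leq_card.
        by apply/subsetP => e; rewrite !inE => /andP[/andP[-> ->] ->].
      by apply/subsetP => e; rewrite !inE => /andP[-> /andP[->]].
    rewrite -natrD => h; apply: (@le_trans _ _ #|G :&: EL|%:R); last by rewrite ler_nat.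
    apply: le_trans h.
    have -> : m%:R / (8 * #|V|%:R ^+ 2) =
        2^-1 * (m%:R / n%:R ^+ 2) * (n%:R ^+ 2 / (4 * #|V|%:R ^+ 2)) :> R.
      by move: (gt_eqF VR) (gt_eqF nR); clear => h1 h2; field; rewrite h1 h2.
    have mn0 : 0 <= m%:R / n%:R ^+ 2 :> R by rewrite divr_ge0 // ltW.
    apply: ler_pM => //.
    + by rewrite mulr_ge0 // invr_ge0.
    + by rewrite divr_ge0 ?ltW // mulr_gt0 // exprn_gt0.
    + by apply: ler_wpM2r => //; move: mu12; clear; lra.
(* Rounded up so that Q k0 >= m, which gives delta^k0 <= x0^m. *)
pose k0 := (m %/ Q).+1.
have y2 : 2 <= m%:R / Q%:R :> R.
  rewrite ler_pdivlMr //; move: malpha => /le_trans /(_ (ler_wpM2r m0 al2)).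
  rewrite mulrC ler_pdivlMr ?mulr_gt0 //; rewrite mul1r //.
have Q1 : 1 <= Q%:R :> R by rewrite ler1n.
have [kb0 kbk0] : 4 * (k%:R * b%:R) * Q%:R <= m%:R :> R /\ k%:R * b%:R * k%:R <= m%:R :> R.
  by apply: (@fingerprint_sizes _ gam) => //; [exact: ltW | rewrite natr1].
have kb : 4 * ((k * b)%:R) <= m%:R / Q%:R :> R by rewrite ler_pdivlMr // natrM.
have kbk : (k * b * k <= m)%N by rewrite -(ler_nat R) !natrM.
have k0le : k0%:R <= m%:R / Q%:R + 1 :> R.
  rewrite /k0 -natr1 lerD2r ler_pdivlMr // -natrM ler_nat.
  exact: leq_trunc_div.
have fin : forall G, G \in B -> exists l : {ffun 'I_k -> {set {set T}}},
     [/\ \bigcup_i l i \subset G, (#|\bigcup_i l i| <= k * b)%N &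
         (k0 <= #|(G :&: D l) :\: \bigcup_i l i|)%N].
  move=> G GB; have [uc reg few] := classB G GB.
  have GY : G \subset Y by move: uc; rewrite inE => /andP[].
  have [|s [sk sG gY gE lose]] := Hg G GY.
    rewrite within_host; apply: (le_trans (ltW few)).
    have mn0 : 0 <= m%:R / n%:R ^+ 2 :> R by rewrite divr_ge0 // ltW.
    have gr0 : 0 <= gam / r%:R by rewrite ltW // divr_gt0.
    have xr : (gam / r%:R) ^+ r * (m%:R / n%:R ^+ 2) ^+ r <= x ^+ r.
      have gm0 := mulr_ge0 gr0 mn0; rewrite -exprMn; apply: lerXn2r => //.
      by rewrite nnegrE; exact: le_trans x1.
    set M := (m%:R / n%:R ^+ 2) ^+ r in xr *.
    have M0 : 0 <= M by exact: exprn_ge0.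
    apply: (@le_trans _ _ (xi * ((gam / r%:R) ^+ r * M) * E0)).
      have -> : xi * ((gam / r%:R) ^+ r * M) * E0 =
          xi * g0 * (gam / r%:R) ^+ r * (M * q n ^+ eFR * n%:R ^+ #|V|).
        have gen (a1 a2 a3 a4 a5 a6 : R) :
            a1 * (a2 * a3) * (a4 * (a5 * a6)) = a1 * a5 * a2 * (a3 * a4 * a6) by ring.
        exact: gen.
      apply: (@le_trans _ _ (alpha * (M * q n ^+ eFR * n%:R ^+ #|V|))).
        by rewrite !mulrA.
      apply: ler_wpM2r => //.
      by rewrite !mulr_ge0 // exprn_ge0.
    by apply: ler_wpM2r; [exact: ltW | rewrite ler_pM2l].
  pose l := [ffun i : 'I_k => nth set0 s i]; exists l.
  have Cl : C l = g s by rewrite /C nth_finfun_seq.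
  have lG (i : 'I_k) : l i \subset G /\ (#|l i| <= b)%N.
    by rewrite ffunE; apply: sG; rewrite mem_nth // sk.
  have Ukb : (#|\bigcup_i l i| <= k * b)%N by apply: card_bigcup_ord => i; case: (lG i).
  split => //; first by apply/bigcupsP => i _; case: (lG i).
  have [_ _ /(_ G GB)] := HD l; rewrite Cl => /(_ gE) h.
  have h2 : (#|G :&: D l| <= #|(G :&: D l) :\: \bigcup_i l i| + k * b)%N.
    rewrite -(cardsID (\bigcup_i l i) (G :&: D l)) addnC leq_add2l.
    by apply: leq_trans Ukb; rewrite subset_leq_card // subsetIr.
  move: h2 lose; rewrite -(ler_nat R) natrD -[in X in _ -> X -> _](ler_nat R) => h2 lose.
  rewrite -(ler_nat R).
  (* Of 2m / Q edges, at most k b lie outside of the container and at most k b in the fingerprint.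
     As k b <= m / (4Q), at least 3m / (2Q) remain, and this is at least m / Q + 1 since m >= 2Q. *)
  have e8 : m%:R / (8 * #|V|%:R ^+ 2) = 2 * (m%:R / Q%:R) :> R.
    rewrite /Q natrM natrX; move: (gt_eqF VR); clear => h1; field.
    by rewrite h1.
  rewrite e8 in h.
  by move: h h2 lose y2 kb k0le; clear; lra.
have BU : B \subset uniform_class E (slots P) m.
  by apply/subsetP => G /classB[].
have Ds l : D l \subset Y /\ #|D l|%:R <= delta * (n ^ 2)%:R by have [] := HD l.
have n20 : (0 < n ^ 2)%N by rewrite expn_gt0 n0.
have := fingerprint_count (fun f => @card_slots _ _ P n F S dP hF f) mn n20 (ltW delta0)
  BU Ds fin.
move/le_trans; apply.
have -> : (#|F| - eFR = r)%N.
  rewrite /r /E /nonroot_edges cardsD; congr (_ - _)%N; apply: eq_card => f.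
  by rewrite !inE; case: (f \in F).
apply: ler_wpM2r; first exact: exprn_ge0.
apply: fingerprint_bound x00 x01 x0b kbk _.
by rewrite mulnC ltnW // ltn_ceil.
Qed.
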